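(* Let $K\ge 1$ and $\lambda>1$, and let $f=h+\overline{g}\in\mathcal{F}_H(\lambda)$, where $$\mathcal{F}_H(\lambda)=\left\{f=h+\overline{g}\in\mathcal{S}_H(K):\ \sup_{z\in\mathbb{D}}(1-|z|^2)\left|\frac{h''(z)}{h'(z)}\right|\le 2\lambda\right\}.$$ Then $f\in\mathbf{h}^p$ for every $p$ with $0<p<1/(\lambda-1)$.
   Context: $\mathbb{D}=\{z\in\mathbb{C}:|z|<1\}$. $\mathcal{H}$ denotes the class of complex-valued harmonic functions $f=h+\overline{g}$ on $\mathbb{D}$, with $h,g$ analytic in $\mathbb{D}$, normalized by $h(0)=g(0)=0$ and $h'(0)=1$. Such an $f$ is sense-preserving if its Jacobian $J_f=|h'|^2-|g'|^2$ is positive on $\mathbb{D}$; then its analytic dilatation $\omega=g'/h'$ is an analytic map $\mathbb{D}\to\mathbb{D}$. $\mathcal{S}_H$ is the class of all sense-preserving univalent (injective) $f\in\mathcal{H}$. For $K\ge 1$ put $k=(K-1)/(K+1)\in[0,1)$, i.e. $K=(1+k)/(1-k)$. $\mathcal{S}_H(K)$ is the class of $f\in\mathcal{S}_H$ that are $K$-quasiconformal, i.e. satisfy $|\omega(z)|\le k$ for all $z\in\mathbb{D}$. For $0<p<\infty$, $\mathbf{h}^p$ is the set of complex-valued harmonic functions $\Phi$ on $\mathbb{D}$ with $\sup_{0<r<1}M_p(r,\Phi)<\infty$, where $M_p(r,\Phi)=\left(\frac{1}{2\pi}\int_0^{2\pi}|\Phi(re^{i\theta})|^p\,d\theta\right)^{1/p}$.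 *)

(* Defs.v *)
(* Stdlib reals with Coquelicot; complex numbers are Coquelicot's [C]. *)
From Stdlib Require Import Reals.
From Coquelicot Require Import Coquelicot.
Open Scope R_scope.

Definition unit_disk (z : C) : Prop := Cmod z < 1.

Definition sup_on {T : Type} (A : T -> Prop) (F : T -> R) : Rbar :=
  Lub_Rbar (fun y => exists t, A t /\ y = F t).

(* Functions on the disk are total functions on [C]; values outside the disk
   never matter. Analyticity means a convergent power series expansion around
   each point. *)
Definition analytic_on_disk (h : C -> C) : Prop :=
  forall z0 : C, unit_disk z0 ->
    exists (rho : R) (a : nat -> C),
      0 < rho /\
      forall z : C, Cmod (z - z0) < rho -> is_pseries a (z - z0)%C (h z).

Definition harmonic_real_on_disk (u : R -> R -> R) : Prop :=
  forall x y : R, unit_disk (x, y) ->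
    ex_diff_n u 2 x y /\
    partial_derive 2 0 u x y + partial_derive 0 2 u x y = 0.

Definition harmonic_on_disk (Phi : C -> C) : Prop :=
  harmonic_real_on_disk (fun x y => Re (Phi (x, y))) /\
  harmonic_real_on_disk (fun x y => Im (Phi (x, y))).

(* A harmonic map f = h + conj g is represented by the pair (h, g), which the
   normalization below determines uniquely on the disk. *)
Definition harm (h g : C -> C) : C -> C := fun z => (h z + Cconj (g z))%C.

Definition class_H (h g : C -> C) : Prop :=
  analytic_on_disk h /\ analytic_on_disk g /\
  h 0%C = 0%C /\ g 0%C = 0%C /\ C_derive h 0%C = 1%C.

Definition jacobian (h g : C -> C) (z : C) : R :=
  (Cmod (C_derive h z)) ^ 2 - (Cmod (C_derive g z)) ^ 2.

Definition sense_preserving (h g : C -> C) : Prop :=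
  forall z : C, unit_disk z -> 0 < jacobian h g z.

Definition univalent (f : C -> C) : Prop :=
  forall z w : C, unit_disk z -> unit_disk w -> f z = f w -> z = w.

Definition class_SH (h g : C -> C) : Prop :=
  class_H h g /\ sense_preserving h g /\ univalent (harm h g).

Definition dilatation (h g : C -> C) (z : C) : C :=
  (C_derive g z / C_derive h z)%C.

Definition class_SHK (K : R) (h g : C -> C) : Prop :=
  class_SH h g /\
  forall z : C, unit_disk z -> Cmod (dilatation h g z) <= (K - 1) / (K + 1).

Definition class_FH (K lambda : R) (h g : C -> C) : Prop :=
  class_SHK K h g /\
  Rbar_le
    (sup_on unit_disk
       (fun z => (1 - (Cmod z) ^ 2) *
                 Cmod (C_derive (C_derive h) z / C_derive h z)))
    (2 * lambda).

(* x^p for x >= 0 and p > 0; [Rpower 0 p] would be 1, not 0. *)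
Definition pow_nonneg (x p : R) : R :=
  if Req_EM_T x 0 then 0 else Rpower x p.

Definition circle_point (r theta : R) : C := (r * cos theta, r * sin theta).

(* For continuous Phi and p > 0 the integrand is continuous, so that [RInt] is
   a genuine integral. *)
Definition Mp (p r : R) (Phi : C -> C) : R :=
  pow_nonneg
    (/ (2 * PI) *
     RInt (fun theta => pow_nonneg (Cmod (Phi (circle_point r theta))) p)
       0 (2 * PI))
    (1 / p).

Definition hp (p : R) (Phi : C -> C) : Prop :=
  harmonic_on_disk Phi /\
  Rbar_lt (sup_on (fun r => 0 < r < 1) (fun r => Mp p r Phi)) p_infty.

(* Main.v *)
Require Import Defs.
From Stdlib Require Import Reals Lra Lia.
From Coquelicot Require Import Coquelicot.
Open Scope R_scope.

(** Membership of [f = h + conj g] in the class gives four facts: [f] is injective,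
    [h'] has no zero, [|g'| <= k |h'|] with [k < 1], and
    [(1 - |z|^2) |h''| <= 2 lambda |h'|].

    The last one, integrated along radii, gives
    [|h'(z)| = O((1 - |z|)^(- lambda))] and hence
    [|f(z)| = O((1 - |z|)^(1 - lambda))] ([derivative_growth], [harm_growth]).
    This alone does not reach the exponent [1 / (lambda - 1)]: the rest of the
    proof makes injectivity count, as in Prawitz's theorem for conformal maps,
    but at a fixed scale and with first derivatives only.

    On a disk of radius [t <= c (1 - |z|)] around [z] the derivative [h'] is nearly
    constant and dominates [g'], and a contraction argument shows that the image of
    that disk contains the ball of radius [(1 - k) / 2 * t * |h'(z)|] around [f(z)]
    ([harm_covers_ball]).  Take about [1 / (1 - r)] equally spaced points [z_j] on the circle of radius [r].
    The small disks around them are disjoint, so by injectivity the image balls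
    are disjoint, and they avoid [0 = f(0)].  Disjoint balls of radii
    [rho_j <= |w_j| <= M] centred at the [w_j] satisfy
    [sum |w_j|^(p-2) rho_j^2 <= C M^p], the discrete form of
    [int_(|w| <= M) |w|^(p-2) dA = C M^p] ([disjoint_balls_weighted]).  With
    [M = O((1 - r)^(1 - lambda))] and an average over rotations of the points this
    becomes, for [q = p (lambda - 1)],
    [int |f|^(p-2) |h'|^2 dtheta <= C (1 - r)^(-1-q)] ([energy_integral_le]).

    Let [I(r)] be the integral of [|f|^p] over the circle of radius [r].  Since
    [|d/dr |f|^p| <= 2 p |f|^(p-1) |h'|], the arithmetic-geometric inequality with
    weights [(1 - r)^(-s)] and [(1 - r)^s], [s = (1 + q) / 2], yields
    [I' <= p (1 - r)^(-s) (I + C)].  As [q < 1], [s < 1] and [(1 - r)^(-s)] is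
    integrable up to [r = 1]; so [log (I + C)] stays bounded
    ([pth_moment_bounded]). *)

(** * Complex power series and complex derivatives *)

(** Complex derivative with its structures fixed: the neighbourhoods of the variable
    come from the absolute value of the field [C], those of the value from the
    product [R * R].  The next two lemmas put it in terms of [Cmod] only. *)
Definition C_is_derive (f : C -> C) (z l : C) : Prop :=
  @is_derive C_AbsRing C_NormedModule f z l.

(** Equations that come from the hierarchy are typed at a structure over [C]; [ring]
    recognises them only at [C] itself. *)
Ltac C_eq := match goal with |- ?a = ?b => change (@eq C a b) end.

Lemma C_is_derive_intro (f : C -> C) (z l : C) :
  (forall eps : R, 0 < eps -> exists delta, 0 < delta /\
    forall w, Cmod (w - z) < delta ->
      Cmod (f w - f z - (w - z) * l) <= eps * Cmod (w - z)) ->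
  C_is_derive f z l.
Proof.
  intros H. split.
  - apply is_linear_scal_l.
  - intros x Hx eps.
    apply (@is_filter_lim_locally_unique C_AbsRing (AbsRing_NormedModule C_AbsRing)) in Hx.
    subst x.
    destruct (H eps (cond_pos eps)) as [d [Hd Hw]].
    apply (@locally_le_locally_norm C_AbsRing (AbsRing_NormedModule C_AbsRing)).
    exists (mkposreal d Hd). intros w Hwd. apply Hw, Hwd.
Qed.

Lemma C_is_derive_elim (f : C -> C) (z l : C) :
  C_is_derive f z l ->
  forall eps : R, 0 < eps -> exists delta, 0 < delta /\
    forall w, Cmod (w - z) < delta ->
      Cmod (f w - f z - (w - z) * l) <= eps * Cmod (w - z).
Proof.
  intros [_ H] eps Heps.
  specialize (H z (fun P HP => HP) (mkposreal eps Heps)).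
  apply (@locally_norm_le_locally C_AbsRing (AbsRing_NormedModule C_AbsRing)) in H.
  destruct H as [d Hd]. exists d; split; [apply cond_pos|].
  intros w Hw. apply (Hd w Hw).
Qed.

Lemma geometric_sum_le (q : R) (n : nat) :
  0 <= q < 1 -> sum_n (fun k => q ^ k) n <= / (1 - q).
Proof.
  intros Hq.
  assert (E : sum_n (fun k => q ^ k) n = (1 - q ^ S n) / (1 - q)).
  { induction n as [|n IH].
    - rewrite sum_O. simpl. field. lra.
    - rewrite sum_Sn, IH. unfold plus; simpl. field. lra. }
  rewrite E. unfold Rdiv. rewrite <- (Rmult_1_l (/ (1 - q))) at 2.
  apply Rmult_le_compat_r.
  - left. apply Rinv_0_lt_compat. lra.
  - assert (0 <= q ^ S n) by (apply pow_le; lra). lra.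
Qed.

Lemma C_series_norm_le (a : nat -> C) (l : C) (c q : R) :
  0 <= q < 1 -> (forall n, Cmod (a n) <= c * q ^ n) ->
  @is_series C_AbsRing C_NormedModule a l -> Cmod l <= c / (1 - q).
Proof.
  intros Hq Ha Hl.
  assert (Hc : 0 <= c).
  { specialize (Ha 0%nat). simpl in Ha. generalize (Cmod_ge_0 (a 0%nat)). lra. }
  assert (Hs : forall n, Cmod (@sum_n C_NormedModule a n)
                         <= c * sum_n (fun k => q ^ k) n).
  { induction n as [|n IH].
    - rewrite !sum_O. apply Ha.
    - rewrite !sum_Sn. unfold plus; simpl.
      eapply Rle_trans; [apply Cmod_triangle|].
      specialize (Ha (S n)). simpl in Ha. lra. }
  assert (L : is_lim_seq (fun n => Cmod (@sum_n C_NormedModule a n)) (Cmod l)).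
  { exact (filterlim_comp _ _ _ _ _ _ _ _ Hl
             (@filterlim_norm C_AbsRing C_NormedModule l)). }
  apply (is_lim_seq_le _ (fun _ => c / (1 - q)) (Cmod l) (c / (1 - q)))
    in L; [exact L| |apply is_lim_seq_const].
  intros n. eapply Rle_trans; [apply Hs|]. unfold Rdiv.
  apply Rmult_le_compat_l; [exact Hc|]. apply geometric_sum_le, Hq.
Qed.

Lemma C_ex_series_geom (a : nat -> C) (c q : R) :
  0 <= q < 1 -> (forall n, Cmod (a n) <= c * q ^ n) ->
  exists l : C, @is_series C_AbsRing C_NormedModule a l.
Proof.
  intros Hq Ha.
  apply (@ex_series_le C_AbsRing C_CompleteNormedModule a (fun n => c * q ^ n)).
  - exact Ha.
  - apply (@ex_series_scal R_AbsRing R_NormedModule c).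
    apply ex_series_geom. rewrite Rabs_pos_eq; lra.
Qed.

Lemma pow_n_Cpow (z : C) (n : nat) : @pow_n C_Ring z n = Cpow z n.
Proof. induction n as [|n IH]; simpl; [reflexivity|]. rewrite <- IH. reflexivity. Qed.

Lemma C_pseries_series (a : nat -> C) (z l : C) :
  @is_pseries C_AbsRing C_NormedModule a z l <->
  @is_series C_AbsRing C_NormedModule (fun n => z ^ n * a n)%C l.
Proof.
  split; intros H; (eapply is_series_ext; [|exact H]); intros n;
    [symmetry|]; exact (f_equal (fun x => (x * a n)%C) (pow_n_Cpow z n)).
Qed.

Lemma C_pseries_bounded (a : nat -> C) (z l : C) :
  @is_pseries C_AbsRing C_NormedModule a z l ->
  exists B, 0 <= B /\ forall n, Cmod (a n) * Cmod z ^ n <= B.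
Proof.
  intros H.
  destruct (@filterlim_bounded C_AbsRing C_NormedModule
    (@sum_n C_NormedModule (fun k => scal (@pow_n C_Ring z k) (a k))))
    as [M HM].
  { exists l. exact H. }
  assert (HM0 : 0 <= M).
  { eapply Rle_trans; [|apply (HM 0%nat)]. apply norm_ge_0. }
  exists (M + M). split; [lra|]. intros n.
  assert (E : Cmod (scal (K := C_AbsRing) (V := C_NormedModule)
                 (@pow_n C_Ring z n) (a n)) = Cmod (a n) * Cmod z ^ n).
  { rewrite pow_n_Cpow. unfold scal; simpl. unfold mult; simpl.
    rewrite Cmod_mult, Cmod_pow. ring. }
  rewrite <- E. destruct n as [|n].
  - specialize (HM 0%nat). rewrite sum_O in HM.
    apply Rle_trans with M; [exact HM|lra].
  - pose proof (HM n) as H1. pose proof (HM (S n)) as H2.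
    rewrite sum_Sn in H2.
    change (norm (K:=C_AbsRing) (V:=C_NormedModule)) with Cmod in H1, H2.
    set (s := @sum_n C_NormedModule _ n) in *.
    set (t := scal _ _) in *. 
    replace (t : C) with (Cplus (Cplus s t) (Copp s)).
    + eapply Rle_trans; [apply Cmod_triangle|]. rewrite Cmod_opp.
      apply Rplus_le_compat; assumption.
    + destruct s, t. unfold Cplus, Copp; simpl. f_equal; ring.
Qed.

(** The left side is one term of the binomial expansion of the right side. *)
Lemma pow_derivative_le (r d : R) (n : nat) :
  0 <= r -> 0 < d -> INR n * r ^ pred n * d <= (r + d) ^ n.
Proof.
  intros Hr Hd. induction n as [|n IH]; [simpl; lra|].
  destruct n as [|n]; [simpl; lra|].
  rewrite S_INR. simpl pred in *.
  change ((r + d) ^ S (S n)) with ((r + d) * (r + d) ^ S n).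
  assert (r * (INR (S n) * r ^ n * d) <= r * (r + d) ^ S n)
    by (apply Rmult_le_compat_l; assumption).
  assert (d * r ^ S n <= d * (r + d) ^ S n).
  { apply Rmult_le_compat_l; [lra|]. apply pow_incr; lra. }
  replace ((INR (S n) + 1) * r ^ S n * d) with
    (r * (INR (S n) * r ^ n * d) + d * r ^ S n) by (simpl; ring).
  lra.
Qed.

(** Second-order remainder of [x ^ n]: multiplying by one more factor [v]
    creates the new error [n u ^ (n-1) (v - u) ^ 2], and geometric growth at the
    larger radius [Rr + d] absorbs all of them at once. *)
Lemma pow_remainder_le (u v : C) (Rr d : R) (n : nat) :
  0 < d -> Cmod u <= Rr -> Cmod v <= Rr ->
  Cmod (v ^ n - u ^ n - (v - u) * (INR n * u ^ pred n))
    <= (Rr + d) ^ n / d ^ 2 * Cmod (v - u) ^ 2.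
Proof.
  intros Hd Hu Hv.
  assert (HR : 0 <= Rr) by (generalize (Cmod_ge_0 u); lra).
  assert (Hder : forall m, INR m * Cmod u ^ pred m * d <= (Rr + d) ^ m).
  { intros m. eapply Rle_trans; [|apply pow_derivative_le; assumption].
    apply Rmult_le_compat_r; [lra|]. apply Rmult_le_compat_l; [apply pos_INR|].
    apply pow_incr. split; [apply Cmod_ge_0|exact Hu]. }
  induction n as [|n IH].
  - replace (v ^ 0 - u ^ 0 - (v - u) * (INR 0 * u ^ pred 0))%C with (RtoC 0)
      by (simpl; ring).
    rewrite Cmod_0. apply Rmult_le_pos; [|apply pow2_ge_0].
    simpl. apply Rmult_le_pos; [lra|]. left. apply Rinv_0_lt_compat.
    simpl. nra.
  - replace (v ^ S n - u ^ S n - (v - u) * (INR (S n) * u ^ pred (S n)))%C with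
      (v * (v ^ n - u ^ n - (v - u) * (INR n * u ^ pred n))
       + (v - u) ^ 2 * (INR n * u ^ pred n))%C.
    2:{ rewrite S_INR, RtoC_plus. destruct n as [|n]; simpl; ring. }
    eapply Rle_trans; [apply Cmod_triangle|].
    rewrite !Cmod_mult, !Cmod_pow, Cmod_R, (Rabs_pos_eq (INR n)) by apply pos_INR.
    set (X := Cmod (v - u) ^ 2) in *. assert (HX : 0 <= X) by apply pow2_ge_0.
    set (T := (Rr + d) ^ n) in *. assert (HT : 0 <= T) by (apply pow_le; lra).
    set (Y := Cmod (_ - _ - _)) in *. assert (HY : 0 <= Y) by apply Cmod_ge_0.
    specialize (Hder n). fold T in Hder.
    assert (A : Cmod v * Y <= Rr * (T / d ^ 2 * X))
      by (apply Rmult_le_compat; auto using Cmod_ge_0).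
    assert (B : X * (INR n * Cmod u ^ pred n) <= X * (T / d)).
    { apply Rmult_le_compat_l; [exact HX|]. apply Rmult_le_reg_r with d; [exact Hd|].
      replace (T / d * d) with T by (field; lra). exact Hder. }
    simpl pow. fold T.
    replace ((Rr + d) * T / (d * (d * 1)) * X) with
      (Rr * (T / d ^ 2 * X) + X * (T / d)) by (field; lra).
    lra.
Qed.

(** Boundedness of [a_n S^n] for one [S] slightly larger than the radii in play makes
    both the differentiated series and the series of second-order remainders
    geometrically convergent; the latter sums to [O(|w - z|^2)]. *)
Lemma C_pseries_derive (a : nat -> C) (h : C -> C) (z0 : C) (rho : R) :
  (forall z, Cmod (z - z0) < rho ->
     @is_pseries C_AbsRing C_NormedModule a (z - z0)%C (h z)) ->
  forall z, Cmod (z - z0) < rho ->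
    C_is_derive h z (C_derive h z) /\
    @is_pseries C_AbsRing C_NormedModule
      (fun n => INR (S n) * a (S n))%C (z - z0)%C (C_derive h z).
Proof.
  intros Hh z Hz.
  set (r0 := Cmod (z - z0)) in *.
  assert (Hr0 : 0 <= r0) by apply Cmod_ge_0.
  set (e := (rho - r0) / 4). assert (He : 0 < e) by (unfold e; lra).
  set (Rr := r0 + e). set (T := Rr + e). set (S0 := T + e).
  assert (HRpos : 0 < Rr) by (unfold Rr; lra).
  assert (HT : 0 < T) by (unfold T; lra).
  assert (HS : 0 < S0) by (unfold S0; lra).
  assert (HSrho : S0 < rho) by (unfold S0, T, Rr, e; lra).
  destruct (C_pseries_bounded a (RtoC S0) (h (z0 + S0)%C)) as [B [HB Hbd]].
  { assert (E : (z0 + S0 - z0)%C = RtoC S0) by ring.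
    rewrite <- E at 1. apply Hh. rewrite E, Cmod_R, Rabs_pos_eq; lra. }
  rewrite Cmod_R, Rabs_pos_eq in Hbd by lra.
  set (q := T / S0).
  assert (Hq : 0 <= q < 1).
  { unfold q. split.
    - left. apply Rdiv_lt_0_compat; assumption.
    - apply Rmult_lt_reg_r with S0; [exact HS|].
      unfold Rdiv. rewrite Rmult_assoc, Rinv_l by lra. unfold S0. lra. }
  assert (HaT : forall n, Cmod (a n) * T ^ n <= B * q ^ n).
  { intros n. replace (T ^ n) with (q ^ n * S0 ^ n).
    - replace (Cmod (a n) * (q ^ n * S0 ^ n)) with
        (Cmod (a n) * S0 ^ n * q ^ n) by ring.
      apply Rmult_le_compat_r; [apply pow_le; lra|apply Hbd].
    - rewrite <- Rpow_mult_distr. f_equal. unfold q. field. lra. }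
  set (b := fun n => (INR (S n) * a (S n))%C).
  assert (Hb : exists l : C, @is_pseries C_AbsRing C_NormedModule b (z - z0)%C l).
  { apply C_ex_series_geom with (c := B * q / e) (q := q); [exact Hq|].
    intros n. rewrite pow_n_Cpow. unfold scal; simpl; unfold mult; simpl.
    unfold b. rewrite !Cmod_mult, Cmod_pow, Cmod_R, Rabs_pos_eq by apply pos_INR.
    fold r0.
    assert (Hd : INR (S n) * r0 ^ n * e <= T ^ S n).
    { apply Rle_trans with ((r0 + e) ^ S n).
      - exact (pow_derivative_le r0 e (S n) Hr0 He).
      - apply pow_incr. unfold T, Rr. lra. }
    apply Rmult_le_reg_r with e; [exact He|].
    replace (B * q / e * q ^ n * e) with (B * q ^ S n) by (simpl; field; lra).
    eapply Rle_trans; [|apply HaT].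
    replace (r0 ^ n * (INR (S n) * Cmod (a (S n))) * e) with
      (Cmod (a (S n)) * (INR (S n) * r0 ^ n * e)) by ring.
    apply Rmult_le_compat_l; [apply Cmod_ge_0|exact Hd]. }
  destruct Hb as [l Hl].
  assert (Hder : C_is_derive h z l).
  { apply C_is_derive_intro. intros eps Heps.
    set (c := B / e ^ 2 / (1 - q)).
    assert (Hc : 0 <= c).
    { unfold c. apply Rmult_le_pos; [apply Rmult_le_pos|].
      - exact HB.
      - left. apply Rinv_0_lt_compat. nra.
      - left. apply Rinv_0_lt_compat. lra. }
    exists (Rmin e (eps / (c + 1))). split.
    { apply Rmin_glb_lt; [exact He|]. apply Rdiv_lt_0_compat; lra. }
    intros w Hw.
    assert (Hw1 : Cmod (w - z) < e)
      by (eapply Rlt_le_trans; [exact Hw|apply Rmin_l]).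
    assert (Hw2 : Cmod (w - z) < eps / (c + 1))
      by (eapply Rlt_le_trans; [exact Hw|apply Rmin_r]).
    assert (HwR : Cmod (w - z0) <= Rr).
    { replace (w - z0)%C with ((w - z) + (z - z0))%C by ring.
      eapply Rle_trans; [apply Cmod_triangle|]. fold r0. unfold Rr. lra. }
    assert (HzR : Cmod (z - z0) <= Rr) by (fold r0; unfold Rr; lra).
    assert (Hwr : Cmod (w - z0) < rho)
      by (unfold Rr, e in *; lra).
    assert (Hser : @is_series C_AbsRing C_NormedModule
      (fun n => a n * ((w - z0) ^ n - (z - z0) ^ n
                 - ((w - z0) - (z - z0)) * (INR n * (z - z0) ^ pred n)))%C
      (h w - h z - (w - z) * l)%C).
    { assert (Hl' : @is_series C_AbsRing C_NormedModule
        (fun n => INR n * (z - z0) ^ pred n * a n)%C l).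
      { apply is_series_decr_1. 
        match goal with |- is_series _ ?x => replace x with l end.
        2:{ unfold plus, opp; simpl. C_eq. ring. }
        eapply is_series_ext; [|exact Hl]. intros n. unfold b.
        rewrite pow_n_Cpow. unfold scal; simpl; unfold mult; simpl. C_eq. ring. }
      pose proof (proj1 (C_pseries_series _ _ _) (Hh w Hwr)) as Hw'.
      pose proof (proj1 (C_pseries_series _ _ _) (Hh z Hz)) as Hz'.
      pose proof (is_series_minus _ _ _ _ Hw' Hz') as H1.
      pose proof (is_series_scal (w - z)%C _ _ Hl') as H2.
      pose proof (is_series_minus _ _ _ _ H1 H2) as H3.
      eapply is_series_ext; [|exact H3].
      intros n. unfold plus, opp, scal; simpl; unfold mult; simpl.
      C_eq. ring. }
    assert (Hle : Cmod (h w - h z - (w - z) * l)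
                  <= B / e ^ 2 * Cmod (w - z) ^ 2 / (1 - q)).
    { refine (C_series_norm_le _ _ _ q Hq _ Hser).
      intros n. rewrite Cmod_mult.
      eapply Rle_trans.
      { apply Rmult_le_compat_l; [apply Cmod_ge_0|].
        apply (pow_remainder_le (z - z0) (w - z0) Rr e n He HzR HwR). }
      replace ((w - z0) - (z - z0))%C with (w - z)%C by ring.
      fold T. specialize (HaT n).
      replace (Cmod (a n) * (T ^ n / e ^ 2 * Cmod (w - z) ^ 2)) with
        (Cmod (a n) * T ^ n * (Cmod (w - z) ^ 2 / e ^ 2)) by (field; lra).
      replace (B / e ^ 2 * Cmod (w - z) ^ 2 * q ^ n) with
        (B * q ^ n * (Cmod (w - z) ^ 2 / e ^ 2)) by (field; lra).
      apply Rmult_le_compat_r; [|exact HaT].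
      apply Rmult_le_pos; [apply pow2_ge_0|].
      left. apply Rinv_0_lt_compat. nra. }
    eapply Rle_trans; [exact Hle|].
    replace (B / e ^ 2 * Cmod (w - z) ^ 2 / (1 - q)) with
      (c * Cmod (w - z) * Cmod (w - z)) by (unfold c; field; lra).
    apply Rmult_le_compat_r; [apply Cmod_ge_0|].
    assert (Cmod (w - z) * (c + 1) < eps).
    { apply Rmult_lt_reg_r with (/ (c + 1)).
      - apply Rinv_0_lt_compat. lra.
      - rewrite Rmult_assoc, Rinv_r by lra. unfold Rdiv in Hw2. lra. }
    generalize (Cmod_ge_0 (w - z)). nra. }
  rewrite (is_C_derive_unique h z l Hder). split; assumption.
Qed.

Lemma analytic_C_derive (h : C -> C) :
  analytic_on_disk h -> analytic_on_disk (C_derive h).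
Proof.
  intros H z0 Hz0. destruct (H z0 Hz0) as [rho [a [Hrho Ha]]].
  exists rho, (fun n => INR (S n) * a (S n))%C. split; [exact Hrho|].
  intros z Hz. apply (C_pseries_derive a h z0 rho Ha z Hz).
Qed.

Lemma analytic_is_derive (h : C -> C) (z : C) :
  analytic_on_disk h -> unit_disk z -> C_is_derive h z (C_derive h z).
Proof.
  intros H Hz. destruct (H z Hz) as [rho [a [Hrho Ha]]].
  apply (C_pseries_derive a h z rho Ha z).
  replace (z - z)%C with (RtoC 0) by ring. rewrite Cmod_0. exact Hrho.
Qed.

(** * Harmonicity and the chain rule along paths *)

Lemma C_is_derive_plus (f g : C -> C) (z l m : C) :
  C_is_derive f z l -> C_is_derive g z m ->
  C_is_derive (fun w => f w + g w)%C z (l + m)%C.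
Proof. exact (is_derive_plus f g z l m). Qed.

Lemma C_is_derive_id (z : C) : C_is_derive (fun w => w) z 1%C.
Proof.
  apply C_is_derive_intro. intros eps Heps. exists 1. split; [lra|].
  intros w _. replace (w - z - (w - z) * 1)%C with (RtoC 0) by ring.
  rewrite Cmod_0. apply Rmult_le_pos; [lra|apply Cmod_ge_0].
Qed.

Lemma C_is_derive_scal (c : C) (f : C -> C) (z l : C) :
  C_is_derive f z l -> C_is_derive (fun w => c * f w)%C z (c * l)%C.
Proof.
  intros H. apply C_is_derive_intro. intros eps Heps.
  pose proof (Cmod_ge_0 c) as Hc.
  destruct (C_is_derive_elim f z l H (eps / (Cmod c + 1))) as [d [Hd Hw]].
  { apply Rdiv_lt_0_compat; lra. }
  exists d. split; [exact Hd|]. intros w Hwd. specialize (Hw w Hwd).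
  replace (c * f w - c * f z - (w - z) * (c * l))%C with
    (c * (f w - f z - (w - z) * l))%C by ring.
  rewrite Cmod_mult.
  set (X := Cmod (f w - f z - (w - z) * l)) in *.
  set (Y := Cmod (w - z)) in *. assert (HY : 0 <= Y) by apply Cmod_ge_0.
  apply Rle_trans with (Cmod c * (eps / (Cmod c + 1) * Y)).
  { apply Rmult_le_compat_l; assumption. }
  replace (Cmod c * (eps / (Cmod c + 1) * Y)) with
    (eps * Y - eps * Y / (Cmod c + 1)) by (field; lra).
  assert (0 <= eps * Y / (Cmod c + 1)).
  { apply Rmult_le_pos; [apply Rmult_le_pos; lra|].
    left; apply Rinv_0_lt_compat; lra. }
  lra.
Qed.

Lemma Cmod_le_2Rmax (z : C) : Cmod z <= 2 * Rmax (Rabs (Re z)) (Rabs (Im z)).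
Proof.
  assert (Hs : sqrt 2 <= 2).
  { rewrite <- (sqrt_square 2) at 2 by lra. apply sqrt_le_1; lra. }
  eapply Rle_trans; [apply Cmod_2Rmax|].
  apply Rmult_le_compat_r; [|exact Hs].
  eapply Rle_trans; [apply Rabs_pos|apply Rmax_l].
Qed.

Lemma C_is_derive_differentiable (f : C -> C) (x y : R) (l : C) :
  C_is_derive f (x, y) l ->
  differentiable_pt_lim (fun u v => Re (f (u, v))) x y (Re l) (- Im l) /\
  differentiable_pt_lim (fun u v => Im (f (u, v))) x y (Im l) (Re l).
Proof.
  intros H.
  assert (G : forall eps : posreal, locally_2d (fun u v =>
     Cmod (f (u, v) - f (x, y) - ((u, v) - (x, y)) * l)
     <= eps * Rmax (Rabs (u - x)) (Rabs (v - y))) x y).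
  { intros eps.
    destruct (C_is_derive_elim f (x, y) l H (eps / 2)) as [d [Hd Hw]].
    { generalize (cond_pos eps). lra. }
    assert (Hd2 : 0 < d / 2) by lra.
    exists (mkposreal _ Hd2). simpl. intros u v Hu Hv.
    pose proof (Cmod_le_2Rmax ((u, v) - (x, y))%C) as HM2.
    change (Rmax _ _) with (Rmax (Rabs (u - x)) (Rabs (v - y))) in HM2.
    set (m := Rmax (Rabs (u - x)) (Rabs (v - y))) in *.
    assert (Hm : 0 <= m)
      by (eapply Rle_trans; [apply (Rabs_pos (u - x))|apply Rmax_l]).
    assert (Hm2 : m < d / 2) by (apply Rmax_lub_lt; assumption).
    eapply Rle_trans; [apply Hw; lra|].
    replace (eps * m) with (eps / 2 * (2 * m)) by field.
    apply Rmult_le_compat_l; [|exact HM2]. generalize (cond_pos eps). lra. }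
  split; intros eps; destruct (G eps) as [d Hd]; exists d; intros u v Hu Hv;
    (eapply Rle_trans; [|apply (Hd u v Hu Hv)]).
  - eapply Rle_trans; [|apply re_le_Cmod]. right. f_equal.
    destruct l, (f (u, v)), (f (x, y)); simpl. ring.
  - eapply Rle_trans; [|apply Rmax_Cmod].
    eapply Rle_trans; [|apply Rmax_r]. right. f_equal.
    destruct l, (f (u, v)), (f (x, y)); simpl. ring.
Qed.

(** Componentwise, so that real calculus applies to each coordinate of a path. *)
Definition path_derive (gam : R -> C) (t : R) (v : C) : Prop :=
  is_derive (fun s => Re (gam s)) t (Re v) /\
  is_derive (fun s => Im (gam s)) t (Im v).

Lemma path_derive_comp (f : C -> C) (gam : R -> C) (t : R) (l v : C) :
  C_is_derive f (gam t) l -> path_derive gam t v ->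
  path_derive (fun s => f (gam s)) t (l * v)%C.
Proof.
  intros Hf [Hr Hi]. destruct (gam t) as [x y] eqn:E.
  apply C_is_derive_differentiable in Hf. destruct Hf as [Hfr Hfi].
  apply is_derive_Reals in Hr. apply is_derive_Reals in Hi.
  replace x with (Re (gam t)) in Hfr, Hfi by (rewrite E; reflexivity).
  replace y with (Im (gam t)) in Hfr, Hfi by (rewrite E; reflexivity).
  assert (Ep : forall s, (Re (gam s), Im (gam s)) = gam s)
    by (intros s; destruct (gam s); reflexivity).
  split.
  - apply is_derive_ext with (fun s => Re (f (Re (gam s), Im (gam s)))).
    { intros s. rewrite Ep. reflexivity. }
    replace (Re (l * v)) with (Re l * Re v + - Im l * Im v)
      by (destruct l, v; simpl; ring).
    apply is_derive_Reals.
    exact (derivable_pt_lim_comp_2d _ _ _ _ _ _ _ _ Hfr Hr Hi).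
  - apply is_derive_ext with (fun s => Im (f (Re (gam s), Im (gam s)))).
    { intros s. rewrite Ep. reflexivity. }
    replace (Im (l * v)) with (Im l * Re v + Re l * Im v)
      by (destruct l, v; simpl; ring).
    apply is_derive_Reals.
    exact (derivable_pt_lim_comp_2d _ _ _ _ _ _ _ _ Hfi Hr Hi).
Qed.

Lemma unit_disk_open (x y : R) :
  unit_disk (x, y) -> locally_2d (fun u v => unit_disk (u, v)) x y.
Proof.
  unfold unit_disk. intros H.
  assert (Hd : 0 < (1 - Cmod (x, y)) / 2) by lra.
  exists (mkposreal _ Hd). simpl. intros u v Hu Hv.
  replace ((u, v) : C) with ((x, y) + ((u, v) - (x, y)))%C by ring.
  eapply Rle_lt_trans; [apply Cmod_triangle|].
  pose proof (Cmod_le_2Rmax ((u, v) - (x, y))%C) as HM.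
  change (Rmax _ _) with (Rmax (Rabs (u - x)) (Rabs (v - y))) in HM.
  assert (Rmax (Rabs (u - x)) (Rabs (v - y)) < (1 - Cmod (x, y)) / 2)
    by (apply Rmax_lub_lt; assumption).
  lra.
Qed.

(** The real and imaginary parts of [h + conj g] are of this form.  The family is
    closed under partial derivatives: [d/dx] differentiates [h] and [g], and [d/dy]
    does so and multiplies [c] and [d] by [i].  Since [i * i = -1], the Laplacian
    vanishes. *)
Definition re_comb (c d : C) (h g : C -> C) : R -> R -> R :=
  fun x y => Re (c * h (x, y) + d * g (x, y)).

Lemma re_comb_differentiable (c d : C) (h g : C -> C) (x y : R) :
  analytic_on_disk h -> analytic_on_disk g -> unit_disk (x, y) ->
  differentiable_pt_lim (re_comb c d h g) x y
    (re_comb c d (C_derive h) (C_derive g) x y)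
    (re_comb (c * Ci) (d * Ci) (C_derive h) (C_derive g) x y).
Proof.
  intros Hh Hg Hz.
  pose proof (C_is_derive_plus _ _ _ _ _
    (C_is_derive_scal c h _ _ (analytic_is_derive h _ Hh Hz))
    (C_is_derive_scal d g _ _ (analytic_is_derive g _ Hg Hz))) as H.
  apply C_is_derive_differentiable in H. destruct H as [H _].
  replace (re_comb (c * Ci) (d * Ci) (C_derive h) (C_derive g) x y) with
    (- Im (c * C_derive h (x, y) + d * C_derive g (x, y))); [exact H|].
  unfold re_comb.
  destruct c, d, (C_derive h (x, y)), (C_derive g (x, y)); simpl. ring.
Qed.

Lemma re_comb_derivatives (c d : C) (h g : C -> C) (x y : R) :
  analytic_on_disk h -> analytic_on_disk g -> unit_disk (x, y) ->
  is_derive (fun u => re_comb c d h g u y) x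
    (re_comb c d (C_derive h) (C_derive g) x y) /\
  is_derive (fun v => re_comb c d h g x v) y
    (re_comb (c * Ci) (d * Ci) (C_derive h) (C_derive g) x y).
Proof.
  intros Hh Hg Hz.
  pose proof (re_comb_differentiable c d h g x y Hh Hg Hz) as H. split.
  - apply is_derive_Reals.
    pose proof (derivable_pt_lim_comp_2d _ (fun u => u) (fun _ => y) x _ _ 1 0
      H (derivable_pt_lim_id x) (derivable_pt_lim_const y x)) as H1.
    rewrite Rmult_1_r, Rmult_0_r, Rplus_0_r in H1. exact H1.
  - apply is_derive_Reals.
    pose proof (derivable_pt_lim_comp_2d _ (fun _ => x) (fun v => v) y _ _ 0 1
      H (derivable_pt_lim_const x y) (derivable_pt_lim_id y)) as H1.
    rewrite Rmult_1_r, Rmult_0_r, Rplus_0_l in H1. exact H1.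
Qed.

Lemma re_comb_ex_diff_n (n : nat) (c d : C) (h g : C -> C) (x y : R) :
  analytic_on_disk h -> analytic_on_disk g -> unit_disk (x, y) ->
  ex_diff_n (re_comb c d h g) n x y.
Proof.
  revert c d h g x y.
  induction n as [|n IH]; intros c d h g x y Hh Hg Hz; simpl.
  - split; [|exact I]. apply differentiable_continuity_pt.
    eexists; eexists. apply re_comb_differentiable; assumption.
  - destruct (re_comb_derivatives c d h g x y Hh Hg Hz) as [H1 H2].
    split; [|split; [|split; [|split]]].
    + apply differentiable_continuity_pt.
      eexists; eexists. apply re_comb_differentiable; assumption.
    + eexists; exact H1.
    + eexists; exact H2.
    + apply ex_diff_n_ext_loc with (re_comb c d (C_derive h) (C_derive g)).
      * destruct (unit_disk_open x y Hz) as [e He]. exists e.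
        intros u v Hu Hv. symmetry. apply is_derive_unique.
        apply re_comb_derivatives; auto.
      * apply IH; auto using analytic_C_derive.
    + apply ex_diff_n_ext_loc with
        (re_comb (c * Ci) (d * Ci) (C_derive h) (C_derive g)).
      * destruct (unit_disk_open x y Hz) as [e He]. exists e.
        intros u v Hu Hv. symmetry. apply is_derive_unique.
        apply re_comb_derivatives; auto.
      * apply IH; auto using analytic_C_derive.
Qed.

Lemma re_comb_harmonic (c d : C) (h g : C -> C) :
  analytic_on_disk h -> analytic_on_disk g ->
  harmonic_real_on_disk (re_comb c d h g).
Proof.
  intros Hh Hg x y Hz. split; [apply re_comb_ex_diff_n; assumption|].
  pose proof (analytic_C_derive _ Hh) as Hh1.
  pose proof (analytic_C_derive _ Hg) as Hg1.
  unfold partial_derive. simpl.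
  destruct (unit_disk_open x y Hz) as [e He].
  assert (E1 : Derive (fun t => Derive (fun t' => re_comb c d h g t' y) t) x
    = re_comb c d (C_derive (C_derive h)) (C_derive (C_derive g)) x y).
  { rewrite (Derive_ext_loc _ (fun t => re_comb c d (C_derive h) (C_derive g) t y)).
    - apply is_derive_unique. apply re_comb_derivatives; auto.
    - exists e. intros t Ht. apply is_derive_unique.
      apply re_comb_derivatives; auto. apply He; [exact Ht|].
      rewrite Rminus_diag, Rabs_R0. apply cond_pos. }
  assert (E2 : Derive (fun t => Derive (fun t' => re_comb c d h g x t') t) y
    = re_comb (c * Ci * Ci) (d * Ci * Ci)
        (C_derive (C_derive h)) (C_derive (C_derive g)) x y).
  { rewrite (Derive_ext_loc _
      (fun t => re_comb (c * Ci) (d * Ci) (C_derive h) (C_derive g) x t)).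
    - apply is_derive_unique. apply re_comb_derivatives; auto.
    - exists e. intros t Ht. apply is_derive_unique.
      apply re_comb_derivatives; auto. apply He; [|exact Ht].
      rewrite Rminus_diag, Rabs_R0. apply cond_pos. }
  transitivity
    (re_comb c d (C_derive (C_derive h)) (C_derive (C_derive g)) x y +
     re_comb (c * Ci * Ci) (d * Ci * Ci)
        (C_derive (C_derive h)) (C_derive (C_derive g)) x y).
  { rewrite <- E1, <- E2. reflexivity. }
  unfold re_comb.
  destruct c, d, (C_derive (C_derive h) (x, y)), (C_derive (C_derive g) (x, y)).
  simpl. ring.
Qed.

Lemma harmonic_real_ext (u v : R -> R -> R) :
  (forall x y, u x y = v x y) ->
  harmonic_real_on_disk u -> harmonic_real_on_disk v.
Proof.
  intros E H x y Hz. destruct (H x y Hz) as [H1 H2].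
  split.
  - apply ex_diff_n_ext_loc with u; [|exact H1].
    exists (mkposreal 1 Rlt_0_1). auto.
  - rewrite <- H2. unfold partial_derive. simpl. f_equal.
    + apply Derive_ext. intros t. apply Derive_ext. auto.
    + apply Derive_ext. intros t. apply Derive_ext. auto.
Qed.

Lemma harm_harmonic (h g : C -> C) :
  analytic_on_disk h -> analytic_on_disk g -> harmonic_on_disk (harm h g).
Proof.
  intros Hh Hg. split.
  - apply harmonic_real_ext with (re_comb 1 1 h g);
      [|apply re_comb_harmonic; assumption].
    intros x y. unfold re_comb, harm. destruct (h (x, y)), (g (x, y)).
    simpl. ring.
  - apply harmonic_real_ext with (re_comb (- Ci) Ci h g);
      [|apply re_comb_harmonic; assumption].
    intros x y. unfold re_comb, harm. destruct (h (x, y)), (g (x, y)).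
    simpl. ring.
Qed.

(** * Differential inequalities along paths, and a fixed point *)

Lemma exp_le_compat (x y : R) : x <= y -> exp x <= exp y.
Proof.
  intros H. destruct (Rle_lt_or_eq_dec _ _ H) as [Hlt| ->]; [|lra].
  left. apply exp_increasing, Hlt.
Qed.

Lemma derive_nonneg_le (F dF : R -> R) (x y : R) :
  x <= y ->
  (forall t, x <= t <= y -> is_derive F t (dF t)) ->
  (forall t, x <= t <= y -> 0 <= dF t) ->
  F x <= F y.
Proof.
  intros Hxy HF Hpos.
  destruct (MVT_gen F x y dF) as [c [Hc E]].
  - intros t Ht. apply HF. rewrite Rmin_left, Rmax_right in Ht by lra. lra.
  - intros t Ht. apply continuity_pt_filterlim.
    apply (ex_derive_continuous F). exists (dF t). apply HF.
    rewrite Rmin_left, Rmax_right in Ht by lra. lra.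
  - rewrite Rmin_left, Rmax_right in Hc by lra.
    specialize (Hpos c Hc).
    assert (0 <= dF c * (y - x)) by (apply Rmult_le_pos; lra). lra.
Qed.

Lemma Cmod_sqr (z : C) : Cmod z ^ 2 = Re z * Re z + Im z * Im z.
Proof. rewrite Cmod2_alt. ring. Qed.

Lemma re_inner_le (u v : C) : Re u * Re v + Im u * Im v <= Cmod u * Cmod v.
Proof.
  replace (Re u * Re v + Im u * Im v) with (Re (Cconj u * v))
    by (destruct u, v; simpl; ring).
  rewrite <- (Cmod_conj u), <- Cmod_mult.
  eapply Rle_trans; [apply Rle_abs|apply re_le_Cmod].
Qed.

(** The derivative of the projection of [gam] on the direction of its chord is at
    most [db]. *)
Lemma path_mean_value (gam dgam : R -> C) (b db : R -> R) (x y : R) :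
  x <= y ->
  (forall t, x <= t <= y -> path_derive gam t (dgam t)) ->
  (forall t, x <= t <= y -> is_derive b t (db t)) ->
  (forall t, x <= t <= y -> Cmod (dgam t) <= db t) ->
  Cmod (gam y - gam x) <= b y - b x.
Proof.
  intros Hxy Hg Hb Hle.
  set (w := (gam y - gam x)%C).
  assert (Hw : 0 <= Cmod w) by apply Cmod_ge_0.
  assert (Hbm : b x <= b y).
  { apply derive_nonneg_le with db; auto. intros t Ht.
    eapply Rle_trans; [apply Cmod_ge_0|apply Hle, Ht]. }
  assert (H : Cmod w * b x - (Re w * Re (gam x) + Im w * Im (gam x)) <=
              Cmod w * b y - (Re w * Re (gam y) + Im w * Im (gam y))).
  { apply (derive_nonneg_le
      (fun t => Cmod w * b t - (Re w * Re (gam t) + Im w * Im (gam t)))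
      (fun t => Cmod w * db t - (Re w * Re (dgam t) + Im w * Im (dgam t))));
      [exact Hxy| |].
    - intros t Ht. destruct (Hg t Ht) as [H1 H2].
      apply (is_derive_minus (fun t => Cmod w * b t)).
      + apply (is_derive_scal b t (Cmod w)), Hb, Ht.
      + apply (is_derive_plus (fun t => Re w * Re (gam t))).
        * apply (is_derive_scal (fun t => Re (gam t))), H1.
        * apply (is_derive_scal (fun t => Im (gam t))), H2.
    - intros t Ht. pose proof (re_inner_le w (dgam t)).
      assert (Cmod w * Cmod (dgam t) <= Cmod w * db t)
        by (apply Rmult_le_compat_l; auto).
      lra. }
  assert (E : Cmod w * Cmod w = Re w * Re w + Im w * Im w)
    by (rewrite <- Cmod_sqr; ring).
  assert (E2 : Re w * Re (gam y) + Im w * Im (gam y)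
               - (Re w * Re (gam x) + Im w * Im (gam x)) = Cmod w * Cmod w).
  { rewrite E. unfold w. destruct (gam x), (gam y); simpl. ring. }
  destruct (Rle_lt_or_eq_dec _ _ Hw) as [Hp|H0]; [|lra].
  apply Rmult_le_reg_l with (Cmod w); [exact Hp|]. lra.
Qed.

(** [|psi|^2 exp (-2 a)] is nonincreasing. *)
Lemma path_gronwall (psi dpsi : R -> C) (a da : R -> R) (x y : R) :
  x <= y ->
  (forall t, x <= t <= y -> path_derive psi t (dpsi t)) ->
  (forall t, x <= t <= y -> is_derive a t (da t)) ->
  (forall t, x <= t <= y -> Cmod (dpsi t) <= da t * Cmod (psi t)) ->
  Cmod (psi y) <= Cmod (psi x) * exp (a y - a x).
Proof.
  intros Hxy Hg Ha Hle.
  set (N := fun t => Re (psi t) * Re (psi t) + Im (psi t) * Im (psi t)).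
  assert (HN : forall t, N t = Cmod (psi t) * Cmod (psi t)).
  { intros t. unfold N. rewrite <- Cmod_sqr. ring. }
  assert (H : - (N x * exp (-2 * a x)) <= - (N y * exp (-2 * a y))).
  { apply (derive_nonneg_le (fun t => - (N t * exp (-2 * a t)))
      (fun t => (2 * da t * N t
         - 2 * (Re (psi t) * Re (dpsi t) + Im (psi t) * Im (dpsi t)))
           * exp (-2 * a t))); [exact Hxy| |].
    - intros t Ht. destruct (Hg t Ht) as [H1 H2]. specialize (Ha t Ht).
      unfold N. 
      set (u := fun t => Re (psi t)) in *. set (v := fun t => Im (psi t)) in *.
      change (is_derive (fun t => - ((u t * u t + v t * v t) * exp (-2 * a t))) t
        ((2 * da t * (u t * u t + v t * v t)
          - 2 * (u t * Re (dpsi t) + v t * Im (dpsi t))) * exp (-2 * a t))).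
      change (is_derive u t (Re (dpsi t))) in H1.
      change (is_derive v t (Im (dpsi t))) in H2.
      clearbody u v.
      auto_derive.
      + repeat split; eexists; eassumption.
      + replace (Derive (fun x => u x) t) with (Re (dpsi t))
          by (symmetry; apply is_derive_unique; exact H1).
        replace (Derive (fun x => v x) t) with (Im (dpsi t))
          by (symmetry; apply is_derive_unique; exact H2).
        replace (Derive (fun x => a x) t) with (da t)
          by (symmetry; apply is_derive_unique; exact Ha).
        ring.
    - intros t Ht. apply Rmult_le_pos; [|left; apply exp_pos].
      pose proof (re_inner_le (psi t) (dpsi t)) as H1.
      pose proof (Cmod_ge_0 (psi t)) as H2.
      assert (Cmod (psi t) * Cmod (dpsi t)
              <= Cmod (psi t) * (da t * Cmod (psi t)))
        by (apply Rmult_le_compat_l; auto).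
      rewrite HN. lra. }
  rewrite !HN in H.
  apply Rsqr_incr_0.
  - unfold Rsqr.
    replace (Cmod (psi y) * Cmod (psi y)) with
      (Cmod (psi y) * Cmod (psi y) * exp (-2 * a y) * exp (2 * a y)).
    2:{ rewrite Rmult_assoc, <- exp_plus.
        replace (-2 * a y + 2 * a y) with 0 by ring. rewrite exp_0. ring. }
    replace (Cmod (psi x) * exp (a y - a x) * (Cmod (psi x) * exp (a y - a x)))
      with (Cmod (psi x) * Cmod (psi x) * exp (-2 * a x) * exp (2 * a y)).
    2:{ replace (Cmod (psi x) * exp (a y - a x) * (Cmod (psi x) * exp (a y - a x)))
        with (Cmod (psi x) * Cmod (psi x) * (exp (a y - a x) * exp (a y - a x)))
        by ring.
        rewrite <- exp_plus, Rmult_assoc, <- exp_plus. do 2 f_equal. ring. }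
    apply Rmult_le_compat_r; [left; apply exp_pos|lra].
  - apply Cmod_ge_0.
  - apply Rmult_le_pos; [apply Cmod_ge_0|left; apply exp_pos].
Qed.

Lemma path_derive_segment (z v : C) (t : R) :
  path_derive (fun s => z + s * v)%C t v.
Proof.
  destruct z as [z1 z2], v as [v1 v2]. split; simpl; auto_derive; trivial; ring.
Qed.

Lemma ball_convex (z u v : C) (t s : R) :
  0 <= s <= 1 -> Cmod (u - z) <= t -> Cmod (v - z) <= t ->
  Cmod (u + s * (v - u) - z) <= t.
Proof.
  intros Hs Hu Hv.
  replace (u + s * (v - u) - z)%C with
    (RtoC (1 - s) * (u - z) + RtoC s * (v - z))%C
    by (rewrite RtoC_minus; ring).
  eapply Rle_trans; [apply Cmod_triangle|].
  rewrite !Cmod_mult, !Cmod_R, !Rabs_pos_eq by lra.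
  assert ((1 - s) * Cmod (u - z) <= (1 - s) * t)
    by (apply Rmult_le_compat_l; lra).
  assert (s * Cmod (v - z) <= s * t) by (apply Rmult_le_compat_l; lra).
  lra.
Qed.

Lemma C_lipschitz_ball (F dF : C -> C) (z : C) (t L : R) :
  (forall w, Cmod (w - z) <= t -> C_is_derive F w (dF w)) ->
  (forall w, Cmod (w - z) <= t -> Cmod (dF w) <= L) ->
  forall u v, Cmod (u - z) <= t -> Cmod (v - z) <= t ->
  Cmod (F v - F u) <= L * Cmod (v - u).
Proof.
  intros HF HL u v Hu Hv.
  replace v with (u + 1 * (v - u))%C at 1 by ring.
  replace u with (u + 0 * (v - u))%C at 3 by ring.
  replace (L * Cmod (v - u)) with (L * Cmod (v - u) * 1 - L * Cmod (v - u) * 0)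
    by ring.
  apply (path_mean_value (fun s => F (u + s * (v - u))%C)
    (fun s => dF (u + s * (v - u)) * (v - u))%C
    (fun s => L * Cmod (v - u) * s) (fun _ => L * Cmod (v - u))).
  - lra.
  - intros s Hs.
    apply (path_derive_comp F (fun s => u + s * (v - u))%C).
    + apply HF, ball_convex; assumption.
    + apply path_derive_segment.
  - intros s _. auto_derive; trivial; ring.
  - intros s Hs. rewrite Cmod_mult.
    apply Rmult_le_compat_r; [apply Cmod_ge_0|].
    apply HL, ball_convex; assumption.
Qed.

(** The iterates started at the centre have geometrically decreasing steps, so the
    series of steps converges. *)
Lemma contraction_fixed_point (Phi : C -> C) (z : C) (t q : R) :
  0 <= q < 1 -> 0 <= t ->
  (forall u, Cmod (u - z) <= t -> Cmod (Phi u - z) <= t) ->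
  (forall u v, Cmod (u - z) <= t -> Cmod (v - z) <= t ->
     Cmod (Phi v - Phi u) <= q * Cmod (v - u)) ->
  exists u, Cmod (u - z) <= t /\ Phi u = u.
Proof.
  intros Hq Ht Hself Hlip.
  set (x := fix x n := match n with O => z | S m => Phi (x m) end).
  assert (Hx : forall n, Cmod (x n - z) <= t).
  { induction n as [|n IH]; simpl; [|apply Hself, IH].
    replace (z - z)%C with (RtoC 0) by ring. rewrite Cmod_0. exact Ht. }
  assert (Hd : forall n, Cmod (x (S n) - x n) <= Cmod (x 1%nat - z) * q ^ n).
  { induction n as [|n IH]; [simpl; lra|].
    change (x (S (S n)) - x (S n))%C with (Phi (x (S n)) - Phi (x n))%C.
    eapply Rle_trans; [apply Hlip; apply Hx|].
    change (q ^ S n) with (q * q ^ n).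
    replace (Cmod (x 1%nat - z) * (q * q ^ n)) with
      (q * (Cmod (x 1%nat - z) * q ^ n)) by ring.
    apply Rmult_le_compat_l; lra. }
  destruct (C_ex_series_geom (fun n => x (S n) - x n)%C _ q Hq Hd) as [l Hl].
  set (u := (l + z)%C).
  assert (Hsum : forall n,
    @sum_n C_NormedModule (fun n => x (S n) - x n)%C n = (x (S n) - z)%C).
  { induction n as [|n IH].
    - rewrite sum_O. reflexivity.
    - rewrite sum_Sn, IH.
      change (@plus C_NormedModule) with Cplus. C_eq. ring. }
  assert (Hlim : is_lim_seq (fun n => Cmod (x (S n) - u)) 0).
  { pose proof (proj1 (@filterlim_locally_ball_norm C_AbsRing nat C_NormedModule
      eventually _ (fun n => (x (S n) - z)%C) l)) as HH.
    apply is_lim_seq_spec. intros eps. 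
    assert (Hl' : filterlim (fun n => (x (S n) - z)%C : C_NormedModule)
       eventually (locally (l : C_NormedModule))).
    { eapply filterlim_ext; [|exact Hl]. exact Hsum. }
    specialize (HH Hl' eps). destruct HH as [n0 Hn0]. exists n0. intros n Hn.
    specialize (Hn0 n Hn). unfold ball_norm in Hn0.
    rewrite Rminus_0_r, Rabs_pos_eq by apply Cmod_ge_0.
    replace (x (S n) - u)%C with ((x (S n) - z) - l)%C by (unfold u; ring).
    exact Hn0. }
  assert (Hu : Cmod (u - z) <= t).
  { assert (Hle : Rbar_le (Cmod (u - z)) (t + 0)).
    { apply is_lim_seq_le with (fun _ => Cmod (u - z))
        (fun n => t + Cmod (x (S n) - u)).
      - intros n. replace (u - z)%C with ((x (S n) - z) + - (x (S n) - u))%C by ring.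
        eapply Rle_trans; [apply Cmod_triangle|]. rewrite Cmod_opp.
        specialize (Hx (S n)). lra.
      - apply is_lim_seq_const.
      - apply (is_lim_seq_plus' (fun _ => t)); [apply is_lim_seq_const|exact Hlim]. }
    simpl in Hle. lra. }
  exists u. split; [exact Hu|].
  assert (H0 : Rbar_le (Cmod (Phi u - u)) (q * 0 + 0)).
  { apply is_lim_seq_le with (fun _ => Cmod (Phi u - u))
      (fun n => q * Cmod (x (S n) - u) + Cmod (x (S (S n)) - u)).
    - intros n.
      replace (Phi u - u)%C with
        (- (x (S (S n)) - Phi u) + (x (S (S n)) - u))%C by ring.
      eapply Rle_trans; [apply Cmod_triangle|]. rewrite Cmod_opp.
      apply Rplus_le_compat_r. apply (Hlip u (x (S n))); auto.
    - apply is_lim_seq_const.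
    - apply is_lim_seq_plus'.
      + apply (is_lim_seq_scal_l _ q 0 Hlim).
      + apply (is_lim_seq_incr_1 (fun n => Cmod (x (S n) - u))), Hlim. }
  simpl in H0.
  assert (E : Cmod (Phi u - u) = 0)
    by (generalize (Cmod_ge_0 (Phi u - u)); lra).
  apply Cmod_eq_0 in E.
  replace (Phi u) with ((Phi u - u) + u)%C by ring. rewrite E. ring.
Qed.

(** * Growth, distortion and covering for the harmonic map *)

(** The facts about the class that the estimates use, with the quotients of
    derivatives cleared of denominators; [k] bounds the dilatation. *)
Record qc_map (k lambda : R) (h g : C -> C) : Prop := {
  qc_k : 0 <= k < 1;
  qc_lambda : 1 < lambda;
  qc_h : analytic_on_disk h;
  qc_g : analytic_on_disk g;
  qc_h0 : h 0%C = 0%C;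
  qc_g0 : g 0%C = 0%C;
  qc_h'0 : C_derive h 0%C = 1%C;
  qc_h'_neq0 : forall z, unit_disk z -> 0 < Cmod (C_derive h z);
  qc_dil : forall z, unit_disk z ->
    Cmod (C_derive g z) <= k * Cmod (C_derive h z);
  qc_preschwarz : forall z, unit_disk z ->
    (1 - Cmod z ^ 2) * Cmod (C_derive (C_derive h) z)
      <= 2 * lambda * Cmod (C_derive h z);
  qc_inj : univalent (harm h g)
}.

Lemma class_FH_qc_map (K lambda : R) (h g : C -> C) :
  1 <= K -> 1 < lambda -> class_FH K lambda h g ->
  qc_map ((K - 1) / (K + 1)) lambda h g.
Proof.
  intros HK Hl [[[[Hh [Hg [H0 [G0 H1]]]] [Hsp Hu]] Hdil] Hsup].
  assert (Hpos : forall z, unit_disk z -> 0 < Cmod (C_derive h z)).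
  { intros z Hz. specialize (Hsp z Hz). unfold jacobian in Hsp.
    destruct (Rle_lt_or_eq_dec _ _ (Cmod_ge_0 (C_derive h z))) as [Hp|He];
      [exact Hp|]. rewrite <- He in Hsp.
    generalize (pow2_ge_0 (Cmod (C_derive g z))). lra. }
  constructor; auto.
  - split.
    + apply Rmult_le_pos; [lra|]. left. apply Rinv_0_lt_compat. lra.
    + apply Rmult_lt_reg_r with (K + 1); [lra|].
      unfold Rdiv. rewrite Rmult_assoc, Rinv_l by lra. lra.
  - intros z Hz. specialize (Hdil z Hz). specialize (Hpos z Hz).
    unfold dilatation in Hdil.
    rewrite Cmod_div in Hdil by (apply Cmod_gt_0; exact Hpos).
    apply Rmult_le_reg_r with (/ Cmod (C_derive h z)).
    + apply Rinv_0_lt_compat, Hpos.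
    + rewrite Rmult_assoc, Rinv_r by lra. unfold Rdiv in *. lra.
  - intros z Hz. specialize (Hpos z Hz).
    assert (Hle : (1 - Cmod z ^ 2) *
       Cmod (C_derive (C_derive h) z / C_derive h z) <= 2 * lambda).
    { destruct (Lub_Rbar_correct (fun y => exists t, unit_disk t /\ y =
        (1 - Cmod t ^ 2) * Cmod (C_derive (C_derive h) t / C_derive h t)))
        as [Hub _].
      assert (H2 : Rbar_le ((1 - Cmod z ^ 2) *
        Cmod (C_derive (C_derive h) z / C_derive h z)) (2 * lambda)).
      { eapply Rbar_le_trans; [|exact Hsup]. apply Hub. exists z. auto. }
      exact H2. }
    rewrite Cmod_div in Hle by (apply Cmod_gt_0; exact Hpos).
    apply Rmult_le_reg_r with (/ Cmod (C_derive h z)).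
    + apply Rinv_0_lt_compat, Hpos.
    + rewrite (Rmult_assoc (2 * lambda)), Rinv_r by lra.
      unfold Rdiv in *. rewrite Rmult_assoc. lra.
Qed.

(** Gronwall along the radius: the coefficient [2 lambda r / (1 - t^2 r^2)] of the
    bound on [h''] has primitive [lambda log ((1 + t r) / (1 - t r))]. *)
Lemma derivative_growth (k lambda : R) (h g : C -> C) (z : C) :
  qc_map k lambda h g -> unit_disk z ->
  Cmod (C_derive h z) <= Rpower 2 lambda * Rpower (1 - Cmod z) (- lambda).
Proof.
  intros Q Hz. unfold unit_disk in Hz.
  pose proof (qc_lambda _ _ _ _ Q) as Hl.
  set (r := Cmod z) in *. assert (Hr : 0 <= r) by apply Cmod_ge_0.
  assert (Hdisk : forall t, 0 <= t <= 1 -> Cmod (t * z) = t * r).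
  { intros t Ht. rewrite Cmod_mult, Cmod_R, Rabs_pos_eq by lra. reflexivity. }
  assert (Htr : forall t, 0 <= t <= 1 -> 0 <= t * r < 1) by (intros; nra).
  assert (H : Cmod (C_derive h (0 + 1 * z)) <=
    Cmod (C_derive h (0 + 0 * z)) *
    exp (lambda * (ln (1 + 1 * r) - ln (1 - 1 * r))
         - lambda * (ln (1 + 0 * r) - ln (1 - 0 * r)))).
  { apply (path_gronwall (fun t => C_derive h (0 + t * z))
      (fun t => C_derive (C_derive h) (0 + t * z) * z)%C
      (fun t => lambda * (ln (1 + t * r) - ln (1 - t * r)))
      (fun t => lambda * (r / (1 + t * r) + r / (1 - t * r)))); [lra| | |].
    - intros t Ht.
      apply (path_derive_comp (C_derive h) (fun s => 0 + s * z)%C).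
      + apply analytic_is_derive; [apply analytic_C_derive, Q|].
        unfold unit_disk. rewrite Cplus_0_l, Hdisk by lra. apply Htr, Ht.
      + apply path_derive_segment.
    - intros t Ht. specialize (Htr t Ht). cbv beta.
      auto_derive; [lra|]. field. lra.
    - intros t Ht. specialize (Htr t Ht).
      rewrite !Cplus_0_l, Cmod_mult. fold r.
      assert (Hd : unit_disk (t * z)) by (unfold unit_disk; rewrite Hdisk; lra).
      pose proof (qc_preschwarz _ _ _ _ Q _ Hd) as Hp.
      rewrite Hdisk in Hp by exact Ht.
      assert (Hs : 0 < 1 - (t * r) ^ 2) by nra.
      replace (lambda * (r / (1 + t * r) + r / (1 - t * r)))
        with (2 * lambda * r / (1 - (t * r) ^ 2)) by (field; split; nra).
      apply Rmult_le_reg_l with (1 - (t * r) ^ 2); [exact Hs|].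
      replace ((1 - (t * r) ^ 2) *
        (2 * lambda * r / (1 - (t * r) ^ 2) * Cmod (C_derive h (t * z))))
        with (2 * lambda * Cmod (C_derive h (t * z)) * r) by (field; lra).
      rewrite <- Rmult_assoc. apply Rmult_le_compat_r; assumption. }
  rewrite !Cplus_0_l, Cmult_1_l, Cmult_0_l, (qc_h'0 _ _ _ _ Q), Cmod_1 in H.
  rewrite !Rmult_0_l, Rplus_0_r, Rminus_0_r, ln_1, !Rmult_1_l in H.
  eapply Rle_trans; [exact H|].
  unfold Rpower. rewrite <- exp_plus.
  assert (ln (1 + r) <= ln 2) by (apply ln_le; lra).
  set (A := ln (1 + r)) in *. set (B := ln (1 - r)). set (D := ln 2) in *.
  assert (Hle : lambda * (A - B) - lambda * (0 - 0) <= lambda * D + - lambda * B)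
    by nra.
  apply exp_le_compat, Hle.
Qed.

Lemma analytic_growth (F : C -> C) (A lambda : R) :
  analytic_on_disk F -> F 0%C = 0%C -> 1 < lambda -> 0 <= A ->
  (forall z, unit_disk z ->
     Cmod (C_derive F z) <= A * Rpower (1 - Cmod z) (- lambda)) ->
  forall z, unit_disk z ->
    Cmod (F z) <= A / (lambda - 1) * Rpower (1 - Cmod z) (1 - lambda).
Proof.
  intros HF H0 Hl HA HdF z Hz. unfold unit_disk in Hz.
  set (r := Cmod z) in *. assert (Hr : 0 <= r) by apply Cmod_ge_0.
  assert (Hdisk : forall t, 0 <= t <= 1 -> Cmod (t * z) = t * r).
  { intros t Ht. rewrite Cmod_mult, Cmod_R, Rabs_pos_eq by lra. reflexivity. }
  assert (Htr : forall t, 0 <= t <= 1 -> 0 <= t * r < 1) by (intros; nra).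
  assert (H : Cmod (F (0 + 1 * z)%C - F (0 + 0 * z)%C) <=
    A / (lambda - 1) * Rpower (1 - 1 * r) (1 - lambda)
    - A / (lambda - 1) * Rpower (1 - 0 * r) (1 - lambda)).
  { apply (path_mean_value (fun t => F (0 + t * z)%C)
      (fun t => C_derive F (0 + t * z) * z)%C
      (fun t => A / (lambda - 1) * Rpower (1 - t * r) (1 - lambda))
      (fun t => A * Rpower (1 - t * r) (- lambda) * r)); [lra| | |].
    - intros t Ht.
      apply (path_derive_comp F (fun s => 0 + s * z)%C).
      + apply analytic_is_derive; [exact HF|].
        unfold unit_disk. rewrite Cplus_0_l, Hdisk by lra. apply Htr, Ht.
      + apply path_derive_segment.
    - intros t Ht. specialize (Htr t Ht). cbv beta.
      replace (Rpower (1 - t * r) (- lambda)) with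
        (Rpower (1 - t * r) (1 - lambda) / (1 - t * r)).
      2:{ replace (1 - lambda) with (1 + - lambda) by ring.
          rewrite Rpower_plus, Rpower_1 by lra. field. lra. }
      unfold Rpower. auto_derive; [lra|]. unfold Rminus. field. lra.
    - intros t Ht. specialize (Htr t Ht).
      rewrite !Cplus_0_l, Cmod_mult. fold r.
      apply Rmult_le_compat_r; [exact Hr|].
      rewrite <- Hdisk by exact Ht. apply HdF.
      unfold unit_disk. rewrite Hdisk; lra. }
  rewrite !Cplus_0_l, Cmult_1_l, Cmult_0_l, H0 in H.
  replace (F z - 0)%C with (F z) in H by ring.
  rewrite Rmult_1_l in H. eapply Rle_trans; [exact H|].
  assert (0 <= A / (lambda - 1) * Rpower (1 - 0 * r) (1 - lambda)).
  { apply Rmult_le_pos; [|left; apply exp_pos].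
    apply Rmult_le_pos; [exact HA|]. left. apply Rinv_0_lt_compat. lra. }
  lra.
Qed.

Definition growth_const (lambda : R) : R := 2 * Rpower 2 lambda / (lambda - 1).

Lemma harm_growth (k lambda : R) (h g : C -> C) (z : C) :
  qc_map k lambda h g -> unit_disk z ->
  Cmod (harm h g z) <= growth_const lambda * Rpower (1 - Cmod z) (1 - lambda).
Proof.
  intros Q Hz. pose proof (qc_lambda _ _ _ _ Q) as Hl.
  pose proof (qc_k _ _ _ _ Q) as Hk.
  assert (HA : 0 <= Rpower 2 lambda) by (left; apply exp_pos).
  pose proof (analytic_growth h _ _ (qc_h _ _ _ _ Q) (qc_h0 _ _ _ _ Q) Hl HA
    (fun w Hw => derivative_growth _ _ _ _ w Q Hw) z Hz) as H1.
  assert (H2 : Cmod (g z) <= Rpower 2 lambda / (lambda - 1)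
                 * Rpower (1 - Cmod z) (1 - lambda)).
  { apply (analytic_growth g _ _ (qc_g _ _ _ _ Q) (qc_g0 _ _ _ _ Q) Hl HA);
      [|exact Hz].
    intros w Hw. eapply Rle_trans; [|apply (derivative_growth _ _ _ _ w Q Hw)].
    eapply Rle_trans; [apply (qc_dil _ _ _ _ Q w Hw)|].
    generalize (Cmod_ge_0 (C_derive h w)). nra. }
  unfold harm. eapply Rle_trans; [apply Cmod_triangle|].
  rewrite Cmod_conj. unfold growth_const.
  replace (2 * Rpower 2 lambda / (lambda - 1) * Rpower (1 - Cmod z) (1 - lambda))
    with (Rpower 2 lambda / (lambda - 1) * Rpower (1 - Cmod z) (1 - lambda)
        + Rpower 2 lambda / (lambda - 1) * Rpower (1 - Cmod z) (1 - lambda))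
    by (field; lra).
  lra.
Qed.

Lemma exp_le_3_below_1 (a : R) : 0 <= a <= 1 -> exp a <= 3.
Proof.
  intros Ha. apply Rle_trans with (exp 1); [|apply exp_le_3].
  apply exp_le_compat, Ha.
Qed.

(** On the disk of radius [c (1 - |z|)] the distance to the unit circle is at least
    [(1 - |z|) / 2], so the logarithmic derivative of [h'] along the segment from [z]
    to [w] is at most [4 lambda c].  Gronwall bounds [h'] by [3 |h'(z)|] there, and
    integrating [h''] once more gives the estimate. *)
Lemma derivative_distortion (k lambda c : R) (h g : C -> C) (z w : C) :
  qc_map k lambda h g -> unit_disk z -> 0 <= c <= / 2 -> 4 * lambda * c <= 1 ->
  Cmod (w - z) <= c * (1 - Cmod z) ->
  Cmod (C_derive h w - C_derive h z) <= 12 * lambda * c * Cmod (C_derive h z).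
Proof.
  intros Q Hz Hc Hlc Hw. unfold unit_disk in Hz.
  pose proof (qc_lambda _ _ _ _ Q) as Hl.
  set (D := Cmod (C_derive h z)).
  assert (HD : 0 <= D) by apply Cmod_ge_0.
  assert (Hseg : forall t, 0 <= t <= 1 ->
    Cmod (z + t * (w - z)) <= (1 + Cmod z) / 2).
  { intros t Ht. eapply Rle_trans; [apply Cmod_triangle|].
    rewrite Cmod_mult, Cmod_R, Rabs_pos_eq by lra.
    pose proof (Cmod_ge_0 (w - z)).
    assert (t * Cmod (w - z) <= 1 * Cmod (w - z))
      by (apply Rmult_le_compat_r; lra).
    assert (c * (1 - Cmod z) <= / 2 * (1 - Cmod z))
      by (apply Rmult_le_compat_r; lra).
    lra. }
  assert (Hdisk : forall t, 0 <= t <= 1 -> unit_disk (z + t * (w - z))).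
  { intros t Ht. unfold unit_disk. specialize (Hseg t Ht). lra. }
  assert (Hpath : forall t, 0 <= t <= 1 ->
    path_derive (fun s => C_derive h (z + s * (w - z))%C) t
      (C_derive (C_derive h) (z + t * (w - z)) * (w - z))%C).
  { intros t Ht. apply (path_derive_comp (C_derive h) (fun s => z + s * (w - z))%C).
    - apply analytic_is_derive; [apply analytic_C_derive, Q|apply Hdisk, Ht].
    - apply path_derive_segment. }
  assert (Hdp : forall t, 0 <= t <= 1 ->
    Cmod (C_derive (C_derive h) (z + t * (w - z)) * (w - z)) <=
    4 * lambda * c * Cmod (C_derive h (z + t * (w - z)))).
  { intros t Ht. set (u := (z + t * (w - z))%C).
    specialize (Hseg t Ht). specialize (Hdisk t Ht). fold u in Hseg, Hdisk.
    pose proof (qc_preschwarz _ _ _ _ Q u Hdisk) as Hp.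
    rewrite Cmod_mult.
    set (X := Cmod (C_derive (C_derive h) u)) in *.
    set (Y := Cmod (C_derive h u)) in *.
    assert (HX : 0 <= X) by apply Cmod_ge_0.
    pose proof (Cmod_ge_0 u) as Hu.
    assert (H1 : (1 - Cmod z) / 2 * X <= (1 - Cmod u ^ 2) * X).
    { apply Rmult_le_compat_r; [exact HX|]. nra. }
    assert (H2 : X * Cmod (w - z) <= X * (c * (1 - Cmod z)))
      by (apply Rmult_le_compat_l; assumption).
    assert (H3 : c * ((1 - Cmod z) / 2 * X) <= c * (2 * lambda * Y))
      by (apply Rmult_le_compat_l; lra).
    lra. }
  assert (Hup : forall t, 0 <= t <= 1 ->
    Cmod (C_derive h (z + t * (w - z))) <= 3 * D).
  { intros t Ht.
    apply Rle_trans with (Cmod (C_derive h (z + 0 * (w - z))) *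
       exp (4 * lambda * c * t - 4 * lambda * c * 0)).
    - apply (path_gronwall (fun s => C_derive h (z + s * (w - z)))
        (fun t => C_derive (C_derive h) (z + t * (w - z)) * (w - z))%C
        (fun t => 4 * lambda * c * t) (fun _ => 4 * lambda * c)); [lra| | |].
      + intros s Hs. apply Hpath. lra.
      + intros s _. cbv beta. auto_derive; [exact I|ring].
      + intros s Hs. apply Hdp. lra.
    - rewrite Cmult_0_l, Cplus_0_r. fold D. rewrite (Rmult_comm 3).
      apply Rmult_le_compat_l; [exact HD|]. apply exp_le_3_below_1.
      assert (0 <= 4 * lambda * c) by nra. nra. }
  replace w with (z + 1 * (w - z))%C at 1 by ring.
  replace z with (z + 0 * (w - z))%C at 3 by ring.
  replace (12 * lambda * c * D) with
    (12 * lambda * c * D * 1 - 12 * lambda * c * D * 0) by ring.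
  apply (path_mean_value (fun s => C_derive h (z + s * (w - z)))
    (fun t => C_derive (C_derive h) (z + t * (w - z)) * (w - z))%C
    (fun t => 12 * lambda * c * D * t) (fun _ => 12 * lambda * c * D));
    [lra|exact Hpath| |].
  - intros s _. cbv beta. auto_derive; [exact I|ring].
  - intros s Hs. specialize (Hdp s Hs). specialize (Hup s Hs).
    assert (0 <= 4 * lambda * c) by nra.
    assert (4 * lambda * c * Cmod (C_derive h (z + s * (w - z)))
       <= 4 * lambda * c * (3 * D)) by (apply Rmult_le_compat_l; assumption).
    lra.
Qed.

(** Chosen so that the distortion [12 lambda c] of [h'] is [(1 - k) / 4], a quarter of
    the relative gap between [|h'|] and [|g'|]. *)
Definition cover_radius (k lambda : R) : R := (1 - k) / (48 * lambda).

Lemma cover_radius_bounds (k lambda : R) :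
  0 <= k < 1 -> 1 < lambda ->
  0 < cover_radius k lambda <= / 48 /\
  48 * lambda * cover_radius k lambda = 1 - k.
Proof.
  intros Hk Hl. unfold cover_radius.
  assert (E : 48 * lambda * ((1 - k) / (48 * lambda)) = 1 - k) by (field; lra).
  assert (0 < (1 - k) / (48 * lambda)) by (apply Rdiv_lt_0_compat; lra).
  repeat split; auto; nra.
Qed.

(** Solve [f(u) = w] by iterating [u - (f(u) - w) / h'(z)], Newton's method with the
    derivative frozen at [z] and the antianalytic part ignored.  The analytic part
    of this map has Lipschitz constant at most [(1 - k) / 4], and the ignored part at
    most [k + (1 - k) / 4]; their sum [(1 + k) / 2] is less than [1].  The
    smallness of [|w - f(z)|] keeps the iteration in the disk. *)
Lemma harm_covers_ball (k lambda : R) (h g : C -> C) (z w : C) (t : R) :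
  qc_map k lambda h g -> unit_disk z ->
  0 <= t <= cover_radius k lambda * (1 - Cmod z) ->
  Cmod (w - harm h g z) <= (1 - k) / 2 * t * Cmod (C_derive h z) ->
  exists u, Cmod (u - z) <= t /\ harm h g u = w.
Proof.
  intros Q Hz Ht Hw.
  pose proof (qc_lambda _ _ _ _ Q) as Hl. pose proof (qc_k _ _ _ _ Q) as Hk.
  destruct (cover_radius_bounds k lambda Hk Hl) as [Hc1 Hc2].
  set (c := cover_radius k lambda) in *.
  set (a := C_derive h z) in *.
  assert (Ha : 0 < Cmod a) by (apply (qc_h'_neq0 _ _ _ _ Q), Hz).
  assert (Ha0 : a <> 0%C) by (apply Cmod_gt_0; exact Ha).
  assert (Hball : forall u, Cmod (u - z) <= t -> unit_disk u).
  { intros u Hu. unfold unit_disk in *.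
    replace u with (z + (u - z))%C by ring.
    eapply Rle_lt_trans; [apply Cmod_triangle|]. nra. }
  assert (Hdist : forall u, Cmod (u - z) <= t ->
    Cmod (C_derive h u - a) <= (1 - k) / 4 * Cmod a).
  { intros u Hu. replace ((1 - k) / 4) with (12 * lambda * c) by lra.
    apply (derivative_distortion k lambda c h g z u Q Hz); lra. }
  assert (HlipA : forall u v, Cmod (u - z) <= t -> Cmod (v - z) <= t ->
    Cmod ((v + - / a * h v) - (u + - / a * h u)) <= (1 - k) / 4 * Cmod (v - u)).
  { apply (C_lipschitz_ball (fun u => u + - / a * h u)%C
      (fun u => 1 + - / a * C_derive h u)%C).
    - intros u Hu. apply C_is_derive_plus; [apply C_is_derive_id|].
      apply C_is_derive_scal, analytic_is_derive; [apply Q|apply Hball, Hu].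
    - intros u Hu.
      replace (1 + - / a * C_derive h u)%C with
        (- / a * (C_derive h u - a))%C by (field; exact Ha0).
      rewrite Cmod_mult, Cmod_opp, Cmod_inv by exact Ha0.
      apply Rmult_le_reg_l with (Cmod a); [exact Ha|].
      rewrite <- Rmult_assoc, Rinv_r, Rmult_1_l by lra.
      rewrite Rmult_comm. apply Hdist, Hu. }
  assert (HlipB : forall u v, Cmod (u - z) <= t -> Cmod (v - z) <= t ->
    Cmod (/ Cconj a * g v - / Cconj a * g u)
      <= (k + (1 - k) / 4) * Cmod (v - u)).
  { assert (Hca : Cconj a <> 0%C)
      by (apply Cmod_gt_0; rewrite Cmod_conj; exact Ha).
    apply (C_lipschitz_ball (fun u => / Cconj a * g u)%C
      (fun u => / Cconj a * C_derive g u)%C).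
    - intros u Hu.
      apply C_is_derive_scal, analytic_is_derive; [apply Q|apply Hball, Hu].
    - intros u Hu. rewrite Cmod_mult, Cmod_inv, Cmod_conj by exact Hca.
      apply Rmult_le_reg_l with (Cmod a); [exact Ha|].
      rewrite <- Rmult_assoc, Rinv_r, Rmult_1_l by lra.
      eapply Rle_trans; [apply (qc_dil _ _ _ _ Q), Hball, Hu|].
      specialize (Hdist u Hu).
      assert (Hh : Cmod (C_derive h u) <= Cmod (C_derive h u - a) + Cmod a).
      { replace (C_derive h u) with ((C_derive h u - a) + a)%C at 1 by ring.
        apply Cmod_triangle. }
      assert (k * Cmod (C_derive h u) <= k * ((1 + (1 - k) / 4) * Cmod a))
        by (apply Rmult_le_compat_l; lra).
      assert (0 <= (1 - k) * (1 - k) * Cmod a)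
        by (apply Rmult_le_pos; [nra|lra]).
      lra. }
  set (Phi := fun u => (u - (harm h g u - w) / a)%C).
  assert (Hlip : forall u v, Cmod (u - z) <= t -> Cmod (v - z) <= t ->
    Cmod (Phi v - Phi u) <= (1 + k) / 2 * Cmod (v - u)).
  { intros u v Hu Hv.
    replace (Phi v - Phi u)%C with
      (((v + - / a * h v) - (u + - / a * h u)) +
       - (/ a * (Cconj (g v) - Cconj (g u))))%C.
    2:{ unfold Phi, harm. field. exact Ha0. }
    eapply Rle_trans; [apply Cmod_triangle|]. rewrite Cmod_opp.
    replace (Cmod (/ a * (Cconj (g v) - Cconj (g u)))) with
      (Cmod (/ Cconj a * g v - / Cconj a * g u)).
    2:{ rewrite <- Cmod_conj. f_equal.
        rewrite Cminus_conj, !Cmult_conj, Cinv_conj, Cconj_conj; [ring|].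
        intros E. apply Ha0. rewrite <- (Cconj_conj a), E.
        unfold Cconj, RtoC; simpl. f_equal. ring. }
    specialize (HlipA u v Hu Hv). specialize (HlipB u v Hu Hv). lra. }
  destruct (contraction_fixed_point Phi z t ((1 + k) / 2)) as [u [Hu E]];
    try lra.
  - intros u Hu.
    replace (Phi u - z)%C with ((Phi u - Phi z) + (Phi z - z))%C by ring.
    eapply Rle_trans; [apply Cmod_triangle|].
    assert (Hzz : Cmod (z - z) <= t).
    { replace (z - z)%C with (RtoC 0) by ring. rewrite Cmod_0. lra. }
    pose proof (Hlip z u Hzz Hu) as H1.
    assert (H2 : Cmod (Phi z - z) <= (1 - k) / 2 * t).
    { replace (Phi z - z)%C with (/ a * (w - harm h g z))%C
        by (unfold Phi; field; exact Ha0).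
      rewrite Cmod_mult, Cmod_inv by exact Ha0.
      apply Rmult_le_reg_l with (Cmod a); [exact Ha|].
      rewrite <- Rmult_assoc, Rinv_r, Rmult_1_l by lra. lra. }
    nra.
  - exact Hlip.
  - exists u. split; [exact Hu|]. unfold Phi in E.
    assert (E2 : ((harm h g u - w) / a)%C = 0%C).
    { replace ((harm h g u - w) / a)%C with
        (u - (u - (harm h g u - w) / a))%C by ring. rewrite E. ring. }
    replace (harm h g u) with ((harm h g u - w) / a * a + w)%C
      by (field; exact Ha0).
    rewrite E2. ring.
Qed.

(** * Packing disjoint balls with a radial weight *)

Lemma sum_n_le (u v : nat -> R) (n : nat) :
  (forall j, (j <= n)%nat -> u j <= v j) -> sum_n u n <= sum_n v n.
Proof.
  induction n as [|n IH]; intros H.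
  - rewrite !sum_O. auto.
  - rewrite !sum_Sn. apply Rplus_le_compat; auto.
Qed.

Lemma sum_n_zero (u : nat -> R) (n : nat) :
  (forall j, (j <= n)%nat -> u j = 0) -> sum_n u n = 0.
Proof.
  induction n as [|n IH]; intros H.
  - rewrite sum_O. auto.
  - rewrite sum_Sn, IH by auto. rewrite H by lia. unfold plus; simpl; ring.
Qed.

Lemma sum_n_at_most_one (u : nat -> R) (n : nat) :
  (forall j, (j <= n)%nat -> u j <= 1) ->
  (forall i j, (i < j <= n)%nat -> u i = 0 \/ u j = 0) ->
  sum_n u n <= 1.
Proof.
  induction n as [|n IH]; intros H1 H2.
  - rewrite sum_O. auto.
  - rewrite sum_Sn. change (sum_n u n + u (S n) <= 1).
    destruct (Req_dec (u (S n)) 0) as [E|E].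
    + rewrite E, Rplus_0_r. apply IH; [auto|].
      intros i j Hij. apply H2. lia.
    + rewrite sum_n_zero; [rewrite Rplus_0_l; auto|].
      intros j Hj. destruct (H2 j (S n)) as [H|H]; [lia|exact H|contradiction].
Qed.

Definition ind (a s x : R) : R := if Rlt_dec (Rabs (x - a)) s then 1 else 0.

Lemma ind_bounds (a s x : R) : 0 <= ind a s x <= 1.
Proof. unfold ind. destruct Rlt_dec; lra. Qed.

Lemma is_RInt_ind (a s L : R) :
  0 <= s -> Rabs a + s <= L -> is_RInt (ind a s) (- L) L (2 * s).
Proof.
  intros Hs Ha.
  assert (H1 : - L <= a - s) by (generalize (Rle_abs (- a)); rewrite Rabs_Ropp; lra).
  assert (H2 : a + s <= L) by (generalize (Rle_abs a); lra).
  assert (E1 : is_RInt (ind a s) (- L) (a - s) 0).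
  { apply is_RInt_ext with (fun _ => 0).
    - intros x Hx. rewrite Rmin_left, Rmax_right in Hx by lra.
      unfold ind. destruct Rlt_dec as [H|H]; [|reflexivity].
      apply Rabs_def2 in H. lra.
    - evar_last; [apply is_RInt_const|].
      unfold scal; simpl; unfold mult; simpl. ring. }
  assert (E2 : is_RInt (ind a s) (a - s) (a + s) (2 * s)).
  { apply is_RInt_ext with (fun _ => 1).
    - intros x Hx. rewrite Rmin_left, Rmax_right in Hx by lra.
      unfold ind. destruct Rlt_dec as [H|H]; [reflexivity|].
      exfalso. apply H. apply Rabs_def1; lra.
    - evar_last; [apply is_RInt_const|].
      unfold scal; simpl; unfold mult; simpl. ring. }
  assert (E3 : is_RInt (ind a s) (a + s) L 0).
  { apply is_RInt_ext with (fun _ => 0).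
    - intros x Hx. rewrite Rmin_left, Rmax_right in Hx by lra.
      unfold ind. destruct Rlt_dec as [H|H]; [|reflexivity].
      apply Rabs_def2 in H. lra.
    - evar_last; [apply is_RInt_const|].
      unfold scal; simpl; unfold mult; simpl. ring. }
  evar_last; [exact (is_RInt_Chasles _ _ _ _ _ _ (is_RInt_Chasles _ _ _ _ _ _ E1 E2) E3)|].
  unfold plus; simpl. ring.
Qed.

Lemma is_RInt_sum_n (f : nat -> R -> R) (I : nat -> R) (a b : R) (n : nat) :
  (forall j, (j <= n)%nat -> is_RInt (f j) a b (I j)) ->
  is_RInt (fun x => sum_n (fun j => f j x) n) a b (sum_n I n).
Proof.
  induction n as [|n IH]; intros H.
  - rewrite sum_O. apply is_RInt_ext with (f 0%nat); [|auto].
    intros x _. rewrite sum_O. reflexivity.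
  - rewrite sum_Sn.
    apply is_RInt_ext with
      (fun x => plus (sum_n (fun j => f j x) n) (f (S n) x)).
    + intros x _. rewrite sum_Sn. reflexivity.
    + apply (is_RInt_plus (fun x => sum_n (fun j => f j x) n)); auto.
Qed.

Lemma is_RInt_le_const (f : R -> R) (a b If M : R) :
  a <= b -> is_RInt f a b If -> (forall x, a <= x <= b -> f x <= M) ->
  If <= (b - a) * M.
Proof.
  intros Hab Hf HM.
  apply (is_RInt_le f (fun _ => M) a b If ((b - a) * M)); auto.
  - apply (is_RInt_const a b M).
  - intros x Hx. apply HM. lra.
Qed.

(** The indicators of the squares sum to at most [1] at every point; integrate this
    first in [u] and then in [v]. *)
Lemma disjoint_squares_area (x y s : nat -> R) (n : nat) (L : R) :
  0 <= L ->
  (forall j, (j <= n)%nat ->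
     0 <= s j /\ Rabs (x j) + s j <= L /\ Rabs (y j) + s j <= L) ->
  (forall i j u v, (i < j <= n)%nat ->
     Rabs (u - x i) < s i -> Rabs (v - y i) < s i ->
     Rabs (u - x j) < s j -> Rabs (v - y j) < s j -> False) ->
  sum_n (fun j => (2 * s j) ^ 2) n <= (2 * L) ^ 2.
Proof.
  intros HL Hs Hdisj.
  assert (Hrow : forall v,
    sum_n (fun j => 2 * s j * ind (y j) (s j) v) n <= 2 * L).
  { intros v.
    replace (2 * L) with ((L - - L) * 1) by ring.
    apply (is_RInt_le_const
      (fun u => sum_n (fun j => ind (x j) (s j) u * ind (y j) (s j) v) n) (- L) L);
      [lra| |].
    - apply (is_RInt_sum_n (fun j u => ind (x j) (s j) u * ind (y j) (s j) v)
        (fun j => 2 * s j * ind (y j) (s j) v)).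
      intros j Hj. destruct (Hs j Hj) as [H1 [H2 H3]].
      apply is_RInt_ext with (fun u => ind (y j) (s j) v * ind (x j) (s j) u).
      + intros u _. apply Rmult_comm.
      + rewrite Rmult_comm.
        apply (is_RInt_scal (ind (x j) (s j)) (- L) L (ind (y j) (s j) v)).
        apply is_RInt_ind; assumption.
    - intros u _. apply sum_n_at_most_one.
      + intros j _. generalize (ind_bounds (x j) (s j) u).
        generalize (ind_bounds (y j) (s j) v). nra.
      + intros i j Hij. unfold ind.
        destruct (Rlt_dec (Rabs (u - x i)) (s i)); [|left; ring].
        destruct (Rlt_dec (Rabs (v - y i)) (s i)); [|left; ring].
        destruct (Rlt_dec (Rabs (u - x j)) (s j)); [|right; ring].
        destruct (Rlt_dec (Rabs (v - y j)) (s j)); [|right; ring].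
        exfalso. eapply Hdisj; eassumption. }
  replace ((2 * L) ^ 2) with ((L - - L) * (2 * L)) by ring.
  apply (is_RInt_le_const
    (fun v => sum_n (fun j => 2 * s j * ind (y j) (s j) v) n) (- L) L);
    [lra| |auto].
  apply (is_RInt_sum_n (fun j v => 2 * s j * ind (y j) (s j) v)
    (fun j => (2 * s j) ^ 2)).
  intros j Hj. destruct (Hs j Hj) as [H1 [H2 H3]].
  replace ((2 * s j) ^ 2) with (2 * s j * (2 * s j)) by ring.
  apply (is_RInt_scal (ind (y j) (s j)) (- L) L (2 * s j)).
  apply is_RInt_ind; assumption.
Qed.

(** Selects the terms of size at most [t] without changing the index set. *)
Definition upto (t r a : R) : R := if Rle_dec r t then a else 0.

(** Replace each ball by the square of half-side [rho_j / 2] inside it.  A ball with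
    centre of modulus at most [t] has radius at most [t], so all the selected squares
    lie in the square of half-side [2 t]. *)
Lemma disjoint_balls_area (w : nat -> C) (rho : nat -> R) (n : nat) (t : R) :
  0 <= t ->
  (forall j, (j <= n)%nat -> 0 <= rho j <= Cmod (w j)) ->
  (forall i j u, (i < j <= n)%nat ->
     Cmod (u - w i) <= rho i -> Cmod (u - w j) <= rho j -> False) ->
  sum_n (fun j => upto t (Cmod (w j)) (rho j ^ 2)) n <= 16 * t ^ 2.
Proof.
  intros Ht Hrho Hdisj.
  set (x := fun j => upto t (Cmod (w j)) (Re (w j))).
  set (y := fun j => upto t (Cmod (w j)) (Im (w j))).
  set (s := fun j => upto t (Cmod (w j)) (rho j / 2)).
  replace (16 * t ^ 2) with ((2 * (2 * t)) ^ 2) by ring.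
  apply Rle_trans with (sum_n (fun j => (2 * s j) ^ 2) n).
  { apply sum_n_le. intros j _. unfold s, upto. right.
    destruct Rle_dec; [field|ring]. }
  apply (disjoint_squares_area x y s n (2 * t)); [lra| |].
  - intros j Hj. specialize (Hrho j Hj). unfold x, y, s, upto.
    destruct Rle_dec as [H|H].
    + pose proof (Rmax_Cmod (w j)) as HM.
      pose proof (Rmax_l (Rabs (fst (w j))) (Rabs (snd (w j)))).
      pose proof (Rmax_r (Rabs (fst (w j))) (Rabs (snd (w j)))).
      unfold Re, Im. repeat split; lra.
    + rewrite Rabs_R0. repeat split; lra.
  - assert (Hin : forall j u v, (j <= n)%nat ->
      Rabs (u - x j) < s j -> Rabs (v - y j) < s j ->
      Cmod ((u, v) - w j) <= rho j).
    { intros j u v Hj. specialize (Hrho j Hj). unfold x, y, s, upto.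
      destruct Rle_dec as [H|H].
      - intros Hu Hv.
        pose proof (Cmod_le_2Rmax ((u, v) - w j)%C) as HM.
        change (Rmax _ _) with
          (Rmax (Rabs (u - Re (w j))) (Rabs (v - Im (w j)))) in HM.
        assert (Rmax (Rabs (u - Re (w j))) (Rabs (v - Im (w j))) <= rho j / 2)
          by (apply Rmax_lub; lra).
        lra.
      - intros Hu. generalize (Rabs_pos (u - 0)). lra. }
    intros i j u v Hij H1 H2 H3 H4.
    apply (Hdisj i j (u, v) Hij); apply Hin; auto; lia.
Qed.

Lemma Rpower_pos (x y : R) : 0 < Rpower x y.
Proof. apply exp_pos. Qed.

(** The constant [4 = 2^2] is the worst case, [q = -2]. *)
Lemma Rpower_comparable (M r q : R) :
  0 < M -> M / 2 < r <= M -> -2 <= q -> Rpower r q <= 4 * Rpower M q.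
Proof.
  intros HM Hr Hq.
  assert (H1 : ln r <= ln M) by (apply ln_le; lra).
  assert (H2 : ln M - ln 2 <= ln r).
  { rewrite <- ln_div by lra. apply ln_le; lra. }
  assert (E4 : 4 = exp (2 * ln 2)).
  { replace (2 * ln 2) with (ln 2 + ln 2) by ring.
    rewrite exp_plus, exp_ln by lra. ring. }
  assert (Hl2 : 0 < ln 2) by (rewrite <- ln_1; apply ln_increasing; lra).
  unfold Rpower. rewrite E4, <- exp_plus.
  assert (Hle : q * ln r <= 2 * ln 2 + q * ln M).
  { destruct (Rle_dec 0 q) as [H|H]; nra. }
  apply exp_le_compat, Hle.
Qed.

Lemma positive_lower_bound (R0 : nat -> R) (n : nat) :
  (forall j, (j <= n)%nat -> 0 < R0 j) ->
  exists d, 0 < d /\ forall j, (j <= n)%nat -> d <= R0 j.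
Proof.
  induction n as [|n IH]; intros H.
  - exists (R0 0%nat). split; [auto|]. intros j Hj.
    replace j with 0%nat by lia. lra.
  - destruct IH as [d [Hd H1]]; [auto|].
    exists (Rmin d (R0 (S n))). split; [apply Rmin_glb_lt; auto|].
    intros j Hj. destruct (Nat.eq_dec j (S n)) as [->|Hne].
    + apply Rmin_r.
    + eapply Rle_trans; [apply Rmin_l|]. apply H1. lia.
Qed.

(** The solution of [K * 2^(-p) + 4 = K], which closes the induction over scales in
    [weighted_sum_le]. *)
Definition dyadic_const (p : R) : R := 4 / (1 - Rpower 2 (- p)).

Lemma dyadic_const_spec (p : R) :
  0 < p -> 0 < dyadic_const p /\
  dyadic_const p * Rpower 2 (- p) + 4 = dyadic_const p.
Proof.
  intros Hp.
  assert (H : Rpower 2 (- p) < 1).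
  { rewrite <- (Rpower_O 2) by lra. apply Rpower_lt; lra. }
  unfold dyadic_const. split; [|field; lra].
  apply Rdiv_lt_0_compat; lra.
Qed.

(** Summation over dyadic scales: on [M / 2 < r_j <= M] the weight is comparable to
    [M^(p-2)], so those terms contribute at most [4 B M^p]; the others obey the same
    bound with [M / 2], and [p > 0] makes the geometric series converge. *)
Lemma weighted_sum_le (r a : nat -> R) (n : nat) (B p M : R) :
  0 < p -> 0 <= B -> 0 < M ->
  (forall j, (j <= n)%nat -> 0 < r j <= M) ->
  (forall j, (j <= n)%nat -> 0 <= a j) ->
  (forall t, 0 < t -> sum_n (fun j => upto t (r j) (a j)) n <= B * t ^ 2) ->
  sum_n (fun j => Rpower (r j) (p - 2) * a j) n
    <= dyadic_const p * B * Rpower M p.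
Proof.
  intros Hp HB HM Hr Ha Hsum.
  destruct (dyadic_const_spec p Hp) as [HK HKE].
  set (K := dyadic_const p) in *.
  (* Induction on the number of dyadic scales that contain some [r_j]. *)
  assert (G : forall m M, 0 < M ->
    (forall j, (j <= n)%nat -> r j <= M -> M / 2 ^ m < r j) ->
    sum_n (fun j => upto M (r j) (Rpower (r j) (p - 2) * a j)) n
      <= K * B * Rpower M p).
  { clear M HM Hr. induction m as [|m IH]; intros M HM Hm.
    - rewrite sum_n_zero.
      + apply Rmult_le_pos; [apply Rmult_le_pos; lra|left; apply Rpower_pos].
      + intros j Hj. unfold upto. destruct Rle_dec as [H|H]; [|reflexivity].
        specialize (Hm j Hj H). simpl in Hm. lra.
    - assert (HM2 : 0 < M / 2) by lra.
      assert (IH' := IH (M / 2) HM2).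
      assert (Hsplit :
        sum_n (fun j => upto M (r j) (Rpower (r j) (p - 2) * a j)) n <=
        sum_n (fun j => upto (M / 2) (r j) (Rpower (r j) (p - 2) * a j)) n +
        4 * Rpower M (p - 2) * sum_n (fun j => upto M (r j) (a j)) n).
      { rewrite <- (sum_n_mult_l (K := R_Ring) (4 * Rpower M (p - 2))).
        rewrite <- (sum_n_plus (G := R_AbelianMonoid)
          (fun j => upto (M / 2) (r j) (Rpower (r j) (p - 2) * a j))).
        apply sum_n_le. intros j Hj. specialize (Ha j Hj).
        pose proof (Rpower_pos M (p - 2)).
        change mult with Rmult. change plus with Rplus.
        unfold upto.
        destruct (Rle_dec (r j) M) as [H1|H1];
          destruct (Rle_dec (r j) (M / 2)) as [H2|H2]; try lra.
        - assert (0 <= 4 * Rpower M (p - 2) * a j)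
            by (apply Rmult_le_pos; lra). lra.
        - rewrite Rplus_0_l. apply Rmult_le_compat_r; [exact Ha|].
          apply Rpower_comparable; lra. }
      eapply Rle_trans; [exact Hsplit|].
      assert (H1 := Hsum M HM).
      assert (H2 : sum_n (fun j => upto (M / 2) (r j)
                     (Rpower (r j) (p - 2) * a j)) n
                   <= K * B * Rpower (M / 2) p).
      { apply IH'. intros j Hj Hle.
        replace (M / 2 / 2 ^ m) with (M / 2 ^ S m).
        - apply Hm; [exact Hj|lra].
        - simpl. field. apply pow_nonzero. lra. }
      assert (E1 : Rpower (M / 2) p = Rpower 2 (- p) * Rpower M p).
      { unfold Rpower. rewrite ln_div by lra. rewrite <- exp_plus.
        f_equal. ring. }
      assert (E2 : Rpower M (p - 2) * M ^ 2 = Rpower M p).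
      { rewrite <- Rpower_pow by exact HM. rewrite <- Rpower_plus.
        f_equal. simpl. ring. }
      rewrite E1 in H2.
      assert (H3 : 4 * Rpower M (p - 2) * sum_n (fun j => upto M (r j) (a j)) n
                   <= 4 * Rpower M (p - 2) * (B * M ^ 2)).
      { apply Rmult_le_compat_l; [|exact H1].
        pose proof (Rpower_pos M (p - 2)). lra. }
      replace (4 * Rpower M (p - 2) * (B * M ^ 2)) with (4 * B * Rpower M p)
        in H3 by (rewrite <- E2; ring).
      rewrite <- HKE at 1.
      replace ((K * Rpower 2 (- p) + 4) * B * Rpower M p) with
        (K * B * (Rpower 2 (- p) * Rpower M p) + 4 * B * Rpower M p) by ring.
      lra. }
  destruct (positive_lower_bound r n) as [d [Hd Hdr]].
  { intros j Hj. apply Hr, Hj. }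
  destruct (pow_lt_1_zero (/ 2) (ltac:(rewrite Rabs_pos_eq; lra)) (d / M))
    as [m Hm]; [apply Rdiv_lt_0_compat; assumption|].
  specialize (Hm m (Nat.le_refl m)).
  rewrite Rabs_pos_eq in Hm by (apply pow_le; lra).
  eapply Rle_trans; [|apply (G m M HM)].
  - apply sum_n_le. intros j Hj. unfold upto.
    destruct Rle_dec as [H|H]; [lra|]. exfalso. apply H, Hr, Hj.
  - intros j Hj _. eapply Rlt_le_trans; [|apply Hdr, Hj].
    unfold Rdiv. rewrite <- pow_inv.
    apply Rmult_lt_reg_l with (/ M); [apply Rinv_0_lt_compat, HM|].
    rewrite <- Rmult_assoc, Rinv_l, Rmult_1_l by lra.
    unfold Rdiv in Hm. lra.
Qed.

Lemma disjoint_balls_weighted (w : nat -> C) (rho : nat -> R) (n : nat) (p M : R) :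
  0 < p ->
  (forall j, (j <= n)%nat -> 0 < Cmod (w j) <= M) ->
  (forall j, (j <= n)%nat -> 0 <= rho j <= Cmod (w j)) ->
  (forall i j u, (i < j <= n)%nat ->
     Cmod (u - w i) <= rho i -> Cmod (u - w j) <= rho j -> False) ->
  sum_n (fun j => Rpower (Cmod (w j)) (p - 2) * rho j ^ 2) n
    <= 16 * dyadic_const p * Rpower M p.
Proof.
  intros Hp HM Hrho Hdisj.
  replace (16 * dyadic_const p) with (dyadic_const p * 16) by ring.
  apply (weighted_sum_le (fun j => Cmod (w j)) (fun j => rho j ^ 2));
    try assumption; try lra.
  - specialize (HM 0%nat (Nat.le_0_l n)). lra.
  - intros j _. apply pow2_ge_0.
  - intros t Ht. apply disjoint_balls_area; auto; lra.
Qed.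

(** * The weighted sum of squared derivatives over points of a circle *)

Lemma half_le_sin (x : R) : 0 <= x <= PI / 3 -> x / 2 <= sin x.
Proof.
  intros Hx. pose proof PI_RGT_0 as Hpi.
  assert (H : sin 0 - 0 / 2 <= sin x - x / 2).
  { apply (derive_nonneg_le (fun t => sin t - t / 2) (fun t => cos t - / 2)).
    - lra.
    - intros t _. auto_derive; [exact I|field].
    - intros t Ht. assert (cos (PI / 3) <= cos t) by (apply cos_decr_1; lra).
      rewrite cos_PI3 in H. lra. }
  rewrite sin_0 in H. lra.
Qed.

Lemma sin_min (x y : R) : 0 <= x <= PI / 2 -> x <= y <= PI - x -> sin x <= sin y.
Proof.
  intros Hx Hy. destruct (Rle_dec y (PI / 2)) as [H|H].
  - apply sin_incr_1; lra.
  - rewrite <- (sin_PI_x y). apply sin_incr_1; lra.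
Qed.

Lemma Cmod_circle_point (r a : R) : 0 <= r -> Cmod (circle_point r a) = r.
Proof.
  intros Hr. unfold Cmod, circle_point; simpl.
  replace (r * cos a * (r * cos a * 1) + r * sin a * (r * sin a * 1))
    with (r * r * (Rsqr (sin a) + Rsqr (cos a))) by (unfold Rsqr; ring).
  rewrite sin2_cos2, Rmult_1_r. apply sqrt_square, Hr.
Qed.

Lemma circle_chord (r a b : R) :
  0 <= r -> 2 * r * Rabs (sin ((a - b) / 2))
            = Cmod (circle_point r a - circle_point r b).
Proof.
  intros Hr.
  unfold Cmod, circle_point, Cminus, Cplus, Copp. cbn [fst snd].
  rewrite <- (Rabs_pos_eq (2 * r)) by lra. rewrite <- Rabs_mult.
  rewrite <- sqrt_Rsqr_abs. f_equal. unfold Rsqr.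
  assert (E : a = b + ((a - b) / 2 + (a - b) / 2)) by field.
  set (d := (a - b) / 2) in *. clearbody d. subst a.
  pose proof (sin2_cos2 b) as Hb. pose proof (sin2_cos2 d) as Hd.
  unfold Rsqr in *.
  rewrite (cos_plus b), (sin_plus b), (cos_plus d d), (sin_plus d d).
  set (cb := cos b) in *. set (sb := sin b) in *.
  set (cd := cos d) in *. set (sd := sin d) in *.
  assert (E1 : cd * cd = 1 - sd * sd) by lra.
  replace (cd * cd - sd * sd) with (1 - 2 * (sd * sd)) by lra.
  replace (sd * cd + cd * sd) with (2 * sd * cd) by ring.
  transitivity (r * r * ((sb * sb + cb * cb) * (4 * (sd * sd) * (sd * sd)
            + 4 * (sd * sd) * (cd * cd)))).
  - rewrite Hb, E1. ring.
  - ring.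
Qed.

(** The shortest chord joins neighbours; it is
    [2 r sin (pi / N) >= r pi / N > 1 / N] for [N = n + 1] points. *)
Lemma roots_separated (r alpha t : R) (n i j : nat) :
  / 2 <= r -> (2 <= n)%nat -> 2 * t * INR (S n) <= 1 -> (i < j <= n)%nat ->
  2 * t < Cmod (circle_point r (alpha + INR i * (2 * PI / INR (S n)))
              - circle_point r (alpha + INR j * (2 * PI / INR (S n)))).
Proof.
  intros Hr Hn Ht Hij. pose proof PI_RGT_0 as Hpi.
  rewrite <- circle_chord by lra.
  set (N := INR (S n)) in *.
  assert (HN : 3 <= N) by (unfold N;
    replace 3 with (INR 3) by (simpl; ring); apply le_INR; lia).
  replace ((alpha + INR i * (2 * PI / N) - (alpha + INR j * (2 * PI / N))) / 2)
    with (- ((INR j - INR i) * (PI / N))) by (field; lra).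
  rewrite sin_neg, Rabs_Ropp.
  assert (Hm1 : 1 <= INR j - INR i).
  { rewrite <- minus_INR by lia. change 1 with (INR 1). apply le_INR. lia. }
  assert (Hm2 : INR j - INR i <= N - 1).
  { rewrite <- minus_INR by lia. unfold N. rewrite S_INR.
    replace (INR n + 1 - 1) with (INR n) by ring. apply le_INR. lia. }
  assert (Hx : 0 < PI / N) by (apply Rdiv_lt_0_compat; lra).
  assert (HxN : PI / N * N = PI) by (field; lra).
  assert (H3 : PI / N <= PI / 3).
  { apply Rmult_le_reg_r with (3 * N); [lra|].
    replace (PI / N * (3 * N)) with (3 * PI) by (field; lra).
    replace (PI / 3 * (3 * N)) with (PI * N) by field. nra. }
  assert (Hs : sin (PI / N) <= sin ((INR j - INR i) * (PI / N))).
  { apply sin_min; [lra|]. split; nra. }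
  pose proof (half_le_sin (PI / N) (conj (Rlt_le _ _ Hx) H3)) as Hh.
  rewrite Rabs_pos_eq by lra.
  assert (Hpi3 : 3 < PI) by (generalize PI2_3_2; lra).
  assert (Ht2 : 2 * t <= / N).
  { apply Rmult_le_reg_r with N; [lra|]. rewrite Rinv_l by lra. exact Ht. }
  assert (HN3 : 3 * / N < PI / N).
  { unfold Rdiv. apply Rmult_lt_compat_r; [apply Rinv_0_lt_compat; lra|lra]. }
  assert (0 < / N) by (apply Rinv_0_lt_compat; lra).
  nra.
Qed.

Lemma harm_zero (k lambda : R) (h g : C -> C) (z : C) :
  qc_map k lambda h g -> unit_disk z -> harm h g z = 0%C -> z = 0%C.
Proof.
  intros Q Hz E. apply (qc_inj _ _ _ _ Q); [exact Hz| |].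
  - unfold unit_disk. rewrite Cmod_0. lra.
  - rewrite E. unfold harm. rewrite (qc_h0 _ _ _ _ Q), (qc_g0 _ _ _ _ Q).
    unfold Cconj, RtoC, Cplus; simpl. f_equal; ring.
Qed.

Lemma harm_circle_pos (k lambda : R) (h g : C -> C) (r a : R) :
  qc_map k lambda h g -> 0 < r < 1 -> 0 < Cmod (harm h g (circle_point r a)).
Proof.
  intros Q Hr. apply Cmod_gt_0. intros E.
  apply (harm_zero _ _ _ _ _ Q) in E.
  - assert (H : Cmod (circle_point r a) = r) by (apply Cmod_circle_point; lra).
    rewrite E, Cmod_0 in H. lra.
  - unfold unit_disk. rewrite Cmod_circle_point; lra.
Qed.

(** This is where injectivity enters, through disjointness of the images of the
    disks of radius [t = c (1 - r)] around the points.  The images contain balls of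
    radius [rho_j] proportional to [t |h'(z_j)|].  A ball that contained the origin
    would give a second zero of [f], because [0] lies in none of the disks; hence
    [rho_j <= |f(z_j)|], as the packing estimate requires. *)
Lemma energy_sum_le (k lambda p r alpha : R) (h g : C -> C) (n : nat) :
  qc_map k lambda h g -> 0 < p -> / 2 <= r < 1 -> (2 <= n)%nat ->
  2 * (cover_radius k lambda * (1 - r)) * INR (S n) <= 1 ->
  sum_n (fun j =>
    let z := circle_point r (alpha + INR j * (2 * PI / INR (S n))) in
    Rpower (Cmod (harm h g z)) (p - 2) * Cmod (C_derive h z) ^ 2) n
  <= 16 * dyadic_const p
       * Rpower (growth_const lambda * Rpower (1 - r) (1 - lambda)) p
       / ((1 - k) / 2 * (cover_radius k lambda * (1 - r))) ^ 2.
Proof.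
  intros Q Hp Hr Hn HN.
  pose proof (qc_lambda _ _ _ _ Q) as Hl. pose proof (qc_k _ _ _ _ Q) as Hk.
  destruct (cover_radius_bounds k lambda Hk Hl) as [Hc _].
  set (t := cover_radius k lambda * (1 - r)) in *.
  assert (Ht : 0 < t) by (unfold t; apply Rmult_lt_0_compat; lra).
  assert (Ht2 : t < / 2) by (unfold t; nra).
  set (z := fun j => circle_point r (alpha + INR j * (2 * PI / INR (S n)))).
  assert (Hzr : forall j, Cmod (z j) = r)
    by (intros j; apply Cmod_circle_point; lra).
  assert (Hz : forall j, unit_disk (z j))
    by (intros j; unfold unit_disk; rewrite Hzr; lra).
  set (b := (1 - k) / 2 * t).
  assert (Hb : 0 < b) by (unfold b; apply Rmult_lt_0_compat; lra).
  set (rho := fun j => b * Cmod (C_derive h (z j))).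
  assert (Hcov : forall j u, Cmod (u - harm h g (z j)) <= rho j ->
    exists v, Cmod (v - z j) <= t /\ harm h g v = u).
  { intros j u Hu. apply (harm_covers_ball k lambda h g (z j) u t Q (Hz j)).
    - rewrite Hzr. fold t. lra.
    - exact Hu. }
  assert (Hvd : forall j v, Cmod (v - z j) <= t -> unit_disk v).
  { intros j v Hv. unfold unit_disk.
    replace v with ((v - z j) + z j)%C by ring.
    eapply Rle_lt_trans; [apply Cmod_triangle|]. rewrite Hzr. unfold t in Hv. nra. }
  assert (H : sum_n (fun j => Rpower (Cmod (harm h g (z j))) (p - 2)
                              * rho j ^ 2) n
    <= 16 * dyadic_const p
       * Rpower (growth_const lambda * Rpower (1 - r) (1 - lambda)) p).
  { apply (disjoint_balls_weighted (fun j => harm h g (z j)) rho n p);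
      [exact Hp| | |].
    - intros j _. split.
      + apply (harm_circle_pos _ _ _ _ _ _ Q). lra.
      + rewrite <- (Hzr j). apply (harm_growth k lambda h g (z j) Q (Hz j)).
    - intros j _. split.
      + apply Rmult_le_pos; [lra|apply Cmod_ge_0].
      + apply Rnot_lt_le. intros Hlt.
        destruct (Hcov j 0%C) as [v [Hv E]].
        { replace (0 - harm h g (z j))%C with (- harm h g (z j))%C by ring.
          rewrite Cmod_opp. lra. }
        apply (harm_zero _ _ _ _ _ Q (Hvd j v Hv)) in E. subst v.
        replace (0 - z j)%C with (- z j)%C in Hv by ring.
        rewrite Cmod_opp, Hzr in Hv. lra.
    - intros i j u Hij Hi Hj.
      destruct (Hcov i u Hi) as [v [Hv E]]. destruct (Hcov j u Hj) as [v' [Hv' E']].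
      assert (v = v').
      { apply (qc_inj _ _ _ _ Q); [apply (Hvd i), Hv|apply (Hvd j), Hv'|congruence]. }
      subst v'.
      pose proof (roots_separated r alpha t n i j (proj1 Hr) Hn HN Hij) as Hsep.
      change (2 * t < Cmod (z i - z j)) in Hsep.
      replace (z i - z j)%C with (- (v - z i) + (v - z j))%C in Hsep by ring.
      pose proof (Cmod_triangle (- (v - z i)) (v - z j)) as Htri.
      rewrite Cmod_opp in Htri. lra. }
  apply Rmult_le_reg_l with (b ^ 2); [apply pow_lt, Hb|].
  fold b.
  replace (b ^ 2 * (16 * dyadic_const p
     * Rpower (growth_const lambda * Rpower (1 - r) (1 - lambda)) p / b ^ 2))
    with (16 * dyadic_const p
     * Rpower (growth_const lambda * Rpower (1 - r) (1 - lambda)) p)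
    by (field; lra).
  eapply Rle_trans; [|exact H].
  rewrite <- (sum_n_mult_l (K := R_Ring)).
  apply sum_n_le. intros j _. right. unfold rho. cbv zeta. fold (z j).
  change mult with Rmult. ring.
Qed.

(** The integral over [n + 1] consecutive intervals of length [d] is the integral over
    one of them of the sum of the translates. *)
Lemma RInt_slices (phi : R -> R) (d B : R) (n : nat) :
  0 <= d -> (forall x, continuous phi x) ->
  (forall a, sum_n (fun j => phi (a + INR j * d)) n <= B) ->
  RInt phi 0 (INR (S n) * d) <= d * B.
Proof.
  intros Hd Hc HB.
  assert (Hex : forall a b, ex_RInt phi a b)
    by (intros a b; apply (@ex_RInt_continuous R_CompleteNormedModule); auto).
  assert (Hslice : forall j, is_RInt (fun x => phi (x + INR j * d)) 0 d
     (RInt phi (INR j * d) (INR (S j) * d))).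
  { intros j.
    apply is_RInt_ext with (fun x => scal 1 (phi (1 * x + INR j * d))).
    { intros x _. unfold scal; simpl; unfold mult; simpl.
      rewrite !Rmult_1_l. reflexivity. }
    apply (is_RInt_comp_lin phi 1 (INR j * d) 0 d).
    replace (1 * 0 + INR j * d) with (INR j * d) by ring.
    replace (1 * d + INR j * d) with (INR (S j) * d) by (rewrite S_INR; ring).
    apply (@RInt_correct R_CompleteNormedModule), Hex. }
  assert (Hsum : forall m, RInt phi 0 (INR (S m) * d) =
    sum_n (fun j => RInt phi (INR j * d) (INR (S j) * d)) m).
  { induction m as [|m IH].
    - rewrite sum_O. simpl INR. rewrite Rmult_0_l. reflexivity.
    - rewrite sum_Sn, <- IH. symmetry. apply (RInt_Chasles phi); apply Hex. }
  rewrite Hsum.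
  replace (d * B) with ((d - 0) * B) by ring.
  apply (is_RInt_le_const (fun x => sum_n (fun j => phi (x + INR j * d)) n) 0 d);
    [exact Hd| |auto].
  apply (is_RInt_sum_n (fun j x => phi (x + INR j * d))). auto.
Qed.

(** * The differential inequality for the circular means *)

Lemma continuity_2d_pt_comp2 (f u v : R -> R -> R) (x y : R) :
  continuity_2d_pt f (u x y) (v x y) ->
  continuity_2d_pt u x y -> continuity_2d_pt v x y ->
  continuity_2d_pt (fun s t => f (u s t) (v s t)) x y.
Proof.
  intros Hf Hu Hv eps. destruct (Hf eps) as [d Hd].
  destruct (Hu d) as [d1 H1]. destruct (Hv d) as [d2 H2].
  exists (mkposreal (Rmin d1 d2) (Rmin_stable_in_posreal d1 d2)). simpl.
  intros s t Hs Ht. apply Hd.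
  - apply H1; eapply Rlt_le_trans; eauto; apply Rmin_l.
  - apply H2; eapply Rlt_le_trans; eauto; apply Rmin_r.
Qed.

Lemma continuity_2d_pt_section (f : R -> R -> R) (x y : R) :
  continuity_2d_pt f x y -> continuous (fun t => f x t) y.
Proof.
  intros H. apply continuity_pt_filterlim. intros eps Heps.
  destruct (H (mkposreal eps Heps)) as [d Hd].
  exists d. split; [apply cond_pos|]. intros t [_ Ht].
  apply Hd; [|exact Ht]. rewrite Rminus_diag, Rabs_R0. apply cond_pos.
Qed.

Lemma continuity_2d_cos (r a : R) : continuity_2d_pt (fun _ t => cos t) r a.
Proof.
  apply (continuity_1d_2d_pt_comp cos (fun _ t => t)).
  - apply continuity_cos.
  - apply continuity_2d_pt_id2.
Qed.

Lemma continuity_2d_sin (r a : R) : continuity_2d_pt (fun _ t => sin t) r a.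
Proof.
  apply (continuity_1d_2d_pt_comp sin (fun _ t => t)).
  - apply continuity_sin.
  - apply continuity_2d_pt_id2.
Qed.

Lemma analytic_polar_continuity (F : C -> C) (r a : R) :
  analytic_on_disk F -> 0 < r < 1 ->
  continuity_2d_pt (fun s t => Re (F (circle_point s t))) r a /\
  continuity_2d_pt (fun s t => Im (F (circle_point s t))) r a.
Proof.
  intros HF Hr.
  assert (Hz : unit_disk (circle_point r a))
    by (unfold unit_disk; rewrite Cmod_circle_point; lra).
  destruct (C_is_derive_differentiable F _ _ _ (analytic_is_derive F _ HF Hz))
    as [H1 H2].
  assert (Hx : continuity_2d_pt (fun s t => s * cos t) r a).
  { apply continuity_2d_pt_mult; [apply continuity_2d_pt_id1|apply continuity_2d_cos]. }
  assert (Hy : continuity_2d_pt (fun s t => s * sin t) r a).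
  { apply continuity_2d_pt_mult; [apply continuity_2d_pt_id1|apply continuity_2d_sin]. }
  split.
  - apply (continuity_2d_pt_comp2 (fun x y => Re (F (x, y)))); auto.
    apply differentiable_continuity_pt. eexists; eexists; exact H1.
  - apply (continuity_2d_pt_comp2 (fun x y => Im (F (x, y)))); auto.
    apply differentiable_continuity_pt. eexists; eexists; exact H2.
Qed.

Definition radial_derivative (h g : C -> C) (r a : R) : C :=
  (C_derive h (circle_point r a) * (cos a, sin a)
   + Cconj (C_derive g (circle_point r a) * (cos a, sin a)))%C.

Lemma harm_radial (h g : C -> C) (r a : R) :
  analytic_on_disk h -> analytic_on_disk g -> 0 < r < 1 ->
  path_derive (fun s => harm h g (circle_point s a)) r (radial_derivative h g r a).
Proof.
  intros Hh Hg Hr.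
  assert (Hz : unit_disk (circle_point r a))
    by (unfold unit_disk; rewrite Cmod_circle_point; lra).
  assert (Hp : path_derive (fun s => circle_point s a) r (cos a, sin a)).
  { unfold circle_point. split; simpl; auto_derive; trivial; ring. }
  destruct (path_derive_comp h _ r _ _ (analytic_is_derive h _ Hh Hz) Hp)
    as [H1 H2].
  destruct (path_derive_comp g _ r _ _ (analytic_is_derive g _ Hg Hz) Hp)
    as [G1 G2].
  split.
  - exact (is_derive_plus _ _ _ _ _ H1 G1).
  - exact (is_derive_plus _ _ _ _ _ H2 (is_derive_opp _ _ _ G2)).
Qed.

Lemma Cmod_radial_le (k lambda : R) (h g : C -> C) (r a : R) :
  qc_map k lambda h g -> 0 < r < 1 ->
  Cmod (radial_derivative h g r a) <= 2 * Cmod (C_derive h (circle_point r a)).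
Proof.
  intros Q Hr. pose proof (qc_k _ _ _ _ Q) as Hk.
  set (z := circle_point r a).
  assert (Hz : unit_disk z)
    by (unfold unit_disk, z; rewrite Cmod_circle_point; lra).
  assert (He : Cmod (cos a, sin a) = 1).
  { replace (cos a, sin a) with (circle_point 1 a)
      by (unfold circle_point; f_equal; ring).
    apply Cmod_circle_point. lra. }
  unfold radial_derivative. fold z.
  eapply Rle_trans; [apply Cmod_triangle|].
  rewrite Cmod_conj, !Cmod_mult, He.
  pose proof (qc_dil _ _ _ _ Q z Hz). pose proof (Cmod_ge_0 (C_derive h z)). nra.
Qed.

Lemma harm_power_continuity (k lambda e : R) (h g : C -> C) (r a : R) :
  qc_map k lambda h g -> 0 < r < 1 ->
  continuity_2d_pt (fun s t => Rpower (Cmod (harm h g (circle_point s t))) e) r a.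
Proof.
  intros Q Hr.
  destruct (analytic_polar_continuity h r a (qc_h _ _ _ _ Q) Hr) as [H1 H2].
  destruct (analytic_polar_continuity g r a (qc_g _ _ _ _ Q) Hr) as [G1 G2].
  pose proof (harm_circle_pos k lambda h g r a Q Hr) as Hpos.
  assert (HN : continuity_2d_pt
    (fun s t => Cmod (harm h g (circle_point s t)) ^ 2) r a).
  { apply continuity_2d_pt_ext with (fun s t =>
      (Re (h (circle_point s t)) + Re (g (circle_point s t)))
      * (Re (h (circle_point s t)) + Re (g (circle_point s t))) +
      (Im (h (circle_point s t)) - Im (g (circle_point s t)))
      * (Im (h (circle_point s t)) - Im (g (circle_point s t)))).
    - intros s t. rewrite Cmod_sqr. reflexivity.
    - apply continuity_2d_pt_plus; apply continuity_2d_pt_mult;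
        first [apply continuity_2d_pt_minus | apply continuity_2d_pt_plus];
        assumption. }
  apply continuity_2d_pt_ext with (fun s t =>
    (fun x => Rpower (sqrt x) e) (Cmod (harm h g (circle_point s t)) ^ 2)).
  { intros s t. cbv beta. rewrite sqrt_pow2 by apply Cmod_ge_0. reflexivity. }
  apply (continuity_1d_2d_pt_comp (fun x => Rpower (sqrt x) e)) with (2 := HN).
  assert (Hp2 : 0 < Cmod (harm h g (circle_point r a)) ^ 2) by (apply pow_lt, Hpos).
  set (x := Cmod (harm h g (circle_point r a)) ^ 2) in *.
  apply continuity_pt_filterlim, (ex_derive_continuous (fun x => Rpower (sqrt x) e)).
  unfold Rpower. auto_derive. repeat split; auto. apply sqrt_lt_R0, Hp2.
Qed.

Lemma harm_power_derive (k lambda p : R) (h g : C -> C) (r a : R) :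
  qc_map k lambda h g -> 0 < r < 1 ->
  is_derive (fun s => Rpower (Cmod (harm h g (circle_point s a))) p) r
    (p * Rpower (Cmod (harm h g (circle_point r a))) (p - 2) *
     (Re (harm h g (circle_point r a)) * Re (radial_derivative h g r a) +
      Im (harm h g (circle_point r a)) * Im (radial_derivative h g r a))).
Proof.
  intros Q Hr.
  destruct (harm_radial h g r a (qc_h _ _ _ _ Q) (qc_g _ _ _ _ Q) Hr) as [H1 H2].
  pose proof (harm_circle_pos k lambda h g r a Q Hr) as Hpos.
  set (u := fun s => Re (harm h g (circle_point s a))) in *.
  set (v := fun s => Im (harm h g (circle_point s a))) in *.
  assert (HC : forall s, Cmod (harm h g (circle_point s a))
                         = sqrt (u s * u s + v s * v s)).
  { intros s. unfold u, v. rewrite <- Cmod_sqr.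
    symmetry. apply sqrt_pow2, Cmod_ge_0. }
  assert (HN : 0 < u r * u r + v r * v r).
  { unfold u, v. rewrite <- Cmod_sqr. apply pow_lt, Hpos. }
  change (is_derive u r (Re (radial_derivative h g r a))) in H1.
  change (is_derive v r (Im (radial_derivative h g r a))) in H2.
  change (Re (harm h g (circle_point r a))) with (u r).
  change (Im (harm h g (circle_point r a))) with (v r).
  apply is_derive_ext with (fun s => Rpower (sqrt (u s * u s + v s * v s)) p).
  { intros s. rewrite HC. reflexivity. }
  rewrite HC.
  set (u' := Re (radial_derivative h g r a)) in *.
  set (v' := Im (radial_derivative h g r a)) in *.
  clearbody u v u' v'. clear HC Hpos.
  set (m := sqrt (u r * u r + v r * v r)).
  assert (Hm : 0 < m) by (apply sqrt_lt_R0, HN).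
  replace (Rpower m (p - 2)) with (Rpower m p / (m * m)).
  2:{ unfold Rminus. rewrite Rpower_plus, Rpower_Ropp.
      replace (Rpower m 2) with (m * m); [field; lra|].
      replace 2 with (INR 2) by (simpl; ring). rewrite Rpower_pow by exact Hm.
      simpl. ring. }
  unfold Rpower. auto_derive.
  - repeat split; try (eexists; eassumption); [exact HN|exact Hm].
  - replace (Derive (fun x => u x) r) with u'
      by (symmetry; apply is_derive_unique; exact H1).
    replace (Derive (fun x => v x) r) with v'
      by (symmetry; apply is_derive_unique; exact H2).
    fold m. field. lra.
Qed.

Definition pth_moment (p : R) (h g : C -> C) (r : R) : R :=
  RInt (fun a => Rpower (Cmod (harm h g (circle_point r a))) p) 0 (2 * PI).

(** The radial derivative of [|f|^p]. *)
Definition radial_density (p : R) (h g : C -> C) (r a : R) : R :=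
  p * Rpower (Cmod (harm h g (circle_point r a))) (p - 2) *
     (Re (harm h g (circle_point r a)) * Re (radial_derivative h g r a) +
      Im (harm h g (circle_point r a)) * Im (radial_derivative h g r a)).

Lemma locally_unit_interval (r : R) : 0 < r < 1 -> locally r (fun s => 0 < s < 1).
Proof. exact (open_and _ _ (open_gt 0) (open_lt 1) r). Qed.

Lemma radial_density_continuity (k lambda p : R) (h g : C -> C) (r a : R) :
  qc_map k lambda h g -> 0 < r < 1 ->
  continuity_2d_pt (radial_density p h g) r a.
Proof.
  intros Q Hr. pose proof (qc_h _ _ _ _ Q) as Hh. pose proof (qc_g _ _ _ _ Q) as Hg.
  destruct (analytic_polar_continuity h r a Hh Hr) as [H1 H2].
  destruct (analytic_polar_continuity g r a Hg Hr) as [G1 G2].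
  destruct (analytic_polar_continuity _ r a (analytic_C_derive _ Hh) Hr) as [H3 H4].
  destruct (analytic_polar_continuity _ r a (analytic_C_derive _ Hg) Hr) as [G3 G4].
  pose proof (continuity_2d_cos r a) as Hc.
  pose proof (continuity_2d_sin r a) as Hs.
  unfold radial_density.
  apply continuity_2d_pt_mult.
  - apply continuity_2d_pt_mult; [apply continuity_2d_pt_const|].
    apply (harm_power_continuity k lambda); assumption.
  - unfold harm, radial_derivative. simpl.
    repeat first [assumption | apply continuity_2d_pt_plus
      | apply continuity_2d_pt_mult | apply continuity_2d_pt_opp].
Qed.

Lemma ex_RInt_continuous_R (f : R -> R) (a b : R) :
  (forall x, continuous f x) -> ex_RInt f a b.
Proof. intros H. apply (@ex_RInt_continuous R_CompleteNormedModule). auto. Qed.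

Lemma harm_power_section (k lambda e : R) (h g : C -> C) (r : R) :
  qc_map k lambda h g -> 0 < r < 1 ->
  forall a, continuous (fun t => Rpower (Cmod (harm h g (circle_point r t))) e) a.
Proof.
  intros Q Hr a.
  apply (continuity_2d_pt_section
    (fun s t => Rpower (Cmod (harm h g (circle_point s t))) e)).
  apply (harm_power_continuity k lambda); assumption.
Qed.

Lemma pth_moment_derive (k lambda p : R) (h g : C -> C) (r : R) :
  qc_map k lambda h g -> 0 < r < 1 ->
  is_derive (pth_moment p h g) r (RInt (radial_density p h g r) 0 (2 * PI)).
Proof.
  intros Q Hr.
  set (F := fun s a => Rpower (Cmod (harm h g (circle_point s a))) p).
  assert (HD : forall s a, 0 < s < 1 ->
    is_derive (fun x => F x a) s (radial_density p h g s a))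
    by (intros s a Hs; apply (harm_power_derive k lambda); assumption).
  assert (H : is_derive (fun s => RInt (fun a => F s a) 0 (2 * PI)) r
    (RInt (fun a => Derive (fun s => F s a) r) 0 (2 * PI))).
  { apply is_derive_RInt_param.
    - apply filter_imp with (2 := locally_unit_interval r Hr).
      intros s Hs a _. eexists. apply HD, Hs.
    - intros a _.
      apply continuity_2d_pt_ext_loc with (radial_density p h g).
      + destruct (locally_unit_interval r Hr) as [d Hd]. exists d.
        intros s t Hs _. symmetry. apply is_derive_unique, HD, Hd, Hs.
      + apply (radial_density_continuity k lambda); assumption.
    - apply filter_imp with (2 := locally_unit_interval r Hr).
      intros s Hs. apply ex_RInt_continuous_R.
      apply (harm_power_section k lambda); assumption. }
  replace (RInt (radial_density p h g r) 0 (2 * PI)) with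
    (RInt (fun a => Derive (fun s => F s a) r) 0 (2 * PI)); [exact H|].
  apply RInt_ext. intros a _. apply is_derive_unique, HD, Hr.
Qed.

Definition energy (p : R) (h g : C -> C) (r a : R) : R :=
  Rpower (Cmod (harm h g (circle_point r a))) (p - 2)
    * Cmod (C_derive h (circle_point r a)) ^ 2.

Lemma energy_continuous (k lambda p : R) (h g : C -> C) (r : R) :
  qc_map k lambda h g -> 0 < r < 1 -> forall a, continuous (energy p h g r) a.
Proof.
  intros Q Hr a.
  apply (continuity_2d_pt_section (energy p h g)).
  destruct (analytic_polar_continuity _ r a
    (analytic_C_derive _ (qc_h _ _ _ _ Q)) Hr) as [H3 H4].
  apply continuity_2d_pt_mult.
  - apply (harm_power_continuity k lambda); assumption.
  - apply continuity_2d_pt_ext with (fun s t =>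
      Re (C_derive h (circle_point s t)) * Re (C_derive h (circle_point s t)) +
      Im (C_derive h (circle_point s t)) * Im (C_derive h (circle_point s t))).
    + intros s t. symmetry. apply Cmod_sqr.
    + apply continuity_2d_pt_plus; apply continuity_2d_pt_mult; assumption.
Qed.

(** The factor [512 pi = 2 pi * 4 * 16 * 4] collects the spacing [2 pi / N <= 8 pi t],
    the packing constant [16] and the square of the factor [1 / 2] in the covering
    radius [(1 - k) / 2 * t]. *)
Definition energy_const (k lambda p : R) : R :=
  512 * PI * dyadic_const p * Rpower (growth_const lambda) p
    / ((1 - k) ^ 2 * cover_radius k lambda).

Lemma growth_const_pos (lambda : R) : 1 < lambda -> 0 < growth_const lambda.
Proof.
  intros Hl. unfold growth_const. pose proof (Rpower_pos 2 lambda).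
  apply Rdiv_lt_0_compat; lra.
Qed.

Lemma energy_const_pos (k lambda p : R) :
  0 <= k < 1 -> 1 < lambda -> 0 < p -> 0 < energy_const k lambda p.
Proof.
  intros Hk Hl Hp. unfold energy_const.
  destruct (cover_radius_bounds k lambda Hk Hl) as [Hc _].
  destruct (dyadic_const_spec p Hp) as [HK _].
  pose proof (Rpower_pos (growth_const lambda) p). pose proof PI_RGT_0.
  apply Rdiv_lt_0_compat.
  - repeat first [assumption | lra | apply Rmult_lt_0_compat].
  - apply Rmult_lt_0_compat; [apply pow_lt|]; lra.
Qed.

(** The number of points is the integer part of [1 / (2 t)], [t = c (1 - r)]: small
    enough for disjointness, and large enough that the spacing is at most
    [8 pi t].  So the sum, of size [t^(-2)] times the packing bound, loses one factor
    [1 / t] on integration. *)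
Lemma energy_integral_le (k lambda p : R) (h g : C -> C) (r : R) :
  qc_map k lambda h g -> 0 < p -> / 2 <= r < 1 ->
  RInt (energy p h g r) 0 (2 * PI)
    <= energy_const k lambda p * Rpower (1 - r) (- 1 - p * (lambda - 1)).
Proof.
  intros Q Hp Hr.
  pose proof (qc_lambda _ _ _ _ Q) as Hl. pose proof (qc_k _ _ _ _ Q) as Hk.
  destruct (cover_radius_bounds k lambda Hk Hl) as [Hc _].
  pose proof (growth_const_pos lambda Hl) as HG. pose proof PI_RGT_0 as Hpi.
  set (c := cover_radius k lambda) in *.
  set (t := c * (1 - r)).
  assert (Ht : 0 < t) by (unfold t; apply Rmult_lt_0_compat; lra).
  assert (Ht2 : t <= / 96).
  { assert (c * (1 - r) <= / 48 * (1 - r)) by (apply Rmult_le_compat_r; lra).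
    unfold t. lra. }
  assert (Hx : 0 <= / (2 * t)) by (left; apply Rinv_0_lt_compat; lra).
  destruct (nfloor_ex (/ (2 * t)) Hx) as [m [Hm1 Hm2]].
  assert (Hx48 : 48 <= / (2 * t)).
  { apply Rmult_le_reg_r with (2 * t); [lra|]. rewrite Rinv_l by lra. lra. }
  assert (Hm47 : (47 <= m)%nat).
  { apply INR_le. replace (INR 47) with 47 by (simpl; ring). lra. }
  destruct m as [|n]; [lia|].
  set (N := INR (S n)) in *.
  assert (HN : 47 < N) by lra.
  assert (HtN : 2 * t * N <= 1).
  { apply Rmult_le_reg_l with (/ (2 * t)); [lra|].
    rewrite <- Rmult_assoc, Rinv_l by lra. lra. }
  assert (Hinv : / N <= 4 * t).
  { apply Rmult_le_reg_l with N; [lra|]. rewrite Rinv_r by lra.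
    assert (/ (2 * t) <= 2 * N) by lra.
    apply Rmult_le_reg_l with (/ (2 * t)); [lra|].
    replace (/ (2 * t) * (N * (4 * t))) with (2 * N) by (field; lra). lra. }
  set (B := 16 * dyadic_const p
       * Rpower (growth_const lambda * Rpower (1 - r) (1 - lambda)) p
       / ((1 - k) / 2 * t) ^ 2).
  assert (HB0 : 0 <= B).
  { unfold B. destruct (dyadic_const_spec p Hp) as [HK _].
    pose proof (Rpower_pos (growth_const lambda * Rpower (1 - r) (1 - lambda)) p).
    left. apply Rdiv_lt_0_compat.
    - repeat first [assumption | lra | apply Rmult_lt_0_compat].
    - apply pow_lt, Rmult_lt_0_compat; lra. }
  assert (H : RInt (energy p h g r) 0 (N * (2 * PI / N)) <= 2 * PI / N * B).
  { apply RInt_slices.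
    - left. apply Rdiv_lt_0_compat; lra.
    - apply (energy_continuous k lambda); [exact Q|lra].
    - intros a. apply (energy_sum_le k lambda p r a h g n Q Hp Hr); [lia|].
      exact HtN. }
  replace (N * (2 * PI / N)) with (2 * PI) in H by (field; lra).
  eapply Rle_trans; [exact H|].
  apply Rle_trans with (2 * PI * (4 * t) * B).
  { apply Rmult_le_compat_r; [exact HB0|]. unfold Rdiv.
    apply Rmult_le_compat_l; lra. }
  right. unfold B.
  rewrite <- Rpower_mult_distr by (auto using Rpower_pos).
  rewrite Rpower_mult.
  replace (- 1 - p * (lambda - 1)) with ((1 - lambda) * p + - (1)) by ring.
  rewrite (Rpower_plus _ (- (1))), Rpower_Ropp, Rpower_1 by lra.
  unfold energy_const. fold c. unfold t. field. lra.
Qed.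

(** [2 X Y <= A X^2 + Y^2 / A] with [X = |f|], [Y = |h'|], [A = (1 - r)^(-s)].  The
    choice of [s] gives both terms the same power of [1 - r]:
    [(1 - r)^s (1 - r)^(- 2 s) = (1 - r)^(-s)]. *)
Lemma pth_moment_derivative_le (k lambda p s : R) (h g : C -> C) (r : R) :
  qc_map k lambda h g -> 0 < p -> / 2 <= r < 1 ->
  2 * s = 1 + p * (lambda - 1) ->
  RInt (radial_density p h g r) 0 (2 * PI)
    <= p * Rpower (1 - r) (- s) * (pth_moment p h g r + energy_const k lambda p).
Proof.
  intros Q Hp Hr Hs. assert (Hr' : 0 < r < 1) by lra.
  pose proof PI_RGT_0 as Hpi.
  set (A := Rpower (1 - r) (- s)). assert (HA : 0 < A) by apply Rpower_pos.
  assert (Hpt : forall a, radial_density p h g r a <=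
     p * A * Rpower (Cmod (harm h g (circle_point r a))) p
     + p / A * energy p h g r a).
  { intros a. unfold radial_density, energy.
    set (z := circle_point r a).
    pose proof (harm_circle_pos k lambda h g r a Q Hr') as Hpos. fold z in Hpos.
    pose proof (Cmod_radial_le k lambda h g r a Q Hr') as Hrad. fold z in Hrad.
    pose proof (re_inner_le (harm h g z) (radial_derivative h g r a)) as Hin.
    set (X := Cmod (harm h g z)) in *. set (Y := Cmod (C_derive h z)) in *.
    set (ip := _ + _) in Hin |- *.
    assert (Hip : ip <= 2 * X * Y).
    { eapply Rle_trans; [exact Hin|].
      replace (2 * X * Y) with (X * (2 * Y)) by ring.
      apply Rmult_le_compat_l; lra. }
    assert (Hag : 2 * X * Y <= A * X ^ 2 + / A * Y ^ 2).
    { assert (0 <= / A * (A * X - Y) ^ 2).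
      { apply Rmult_le_pos; [left; apply Rinv_0_lt_compat, HA|apply pow2_ge_0]. }
      replace (/ A * (A * X - Y) ^ 2) with (A * X ^ 2 + / A * Y ^ 2 - 2 * X * Y)
        in H by (field; lra).
      lra. }
    assert (EX : Rpower X p = Rpower X (p - 2) * X ^ 2).
    { rewrite <- Rpower_pow by exact Hpos. rewrite <- Rpower_plus.
      f_equal. simpl. ring. }
    rewrite EX. pose proof (Rpower_pos X (p - 2)) as HP.
    set (P := Rpower X (p - 2)) in *.
    replace (p * A * (P * X ^ 2) + p / A * (P * Y ^ 2)) with
      (p * P * (A * X ^ 2 + / A * Y ^ 2)) by (field; lra).
    apply Rmult_le_compat_l; [|lra].
    left. apply Rmult_lt_0_compat; assumption. }
  assert (Hex1 : ex_RInt (fun a => Rpower (Cmod (harm h g (circle_point r a))) p)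
     0 (2 * PI)).
  { apply ex_RInt_continuous_R, (harm_power_section k lambda); assumption. }
  assert (Hex2 : ex_RInt (energy p h g r) 0 (2 * PI)).
  { apply ex_RInt_continuous_R, (energy_continuous k lambda); assumption. }
  assert (Hle : RInt (radial_density p h g r) 0 (2 * PI) <=
     p * A * pth_moment p h g r + p / A * RInt (energy p h g r) 0 (2 * PI)).
  { apply (is_RInt_le (radial_density p h g r)
      (fun a => p * A * Rpower (Cmod (harm h g (circle_point r a))) p
                + p / A * energy p h g r a) 0 (2 * PI)); [lra| | |].
    - apply (@RInt_correct R_CompleteNormedModule), ex_RInt_continuous_R.
      intros a. apply (continuity_2d_pt_section (radial_density p h g)).
      apply (radial_density_continuity k lambda); assumption.
    - apply (is_RInt_plus
        (fun a => p * A * Rpower (Cmod (harm h g (circle_point r a))) p)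
        (fun a => p / A * energy p h g r a)).
      + apply (is_RInt_scal (fun a => Rpower (Cmod (harm h g (circle_point r a))) p)
          0 (2 * PI) (p * A)).
        apply (@RInt_correct R_CompleteNormedModule), Hex1.
      + apply (is_RInt_scal (energy p h g r) 0 (2 * PI) (p / A)).
        apply (@RInt_correct R_CompleteNormedModule), Hex2.
    - intros a _. apply Hpt. }
  pose proof (energy_integral_le k lambda p h g r Q Hp Hr) as HE.
  assert (HA2 : / A * Rpower (1 - r) (- 1 - p * (lambda - 1)) = A).
  { unfold A. rewrite <- Rpower_Ropp, <- Rpower_plus. f_equal. lra. }
  assert (HpA : 0 <= p / A) by (left; apply Rdiv_lt_0_compat; assumption).
  assert (H2 : p / A * RInt (energy p h g r) 0 (2 * PI)
    <= p / A * (energy_const k lambda p * Rpower (1 - r) (- 1 - p * (lambda - 1))))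
    by (apply Rmult_le_compat_l; assumption).
  replace (p / A * (energy_const k lambda p
      * Rpower (1 - r) (- 1 - p * (lambda - 1))))
    with (p * A * energy_const k lambda p) in H2
    by (rewrite <- HA2 at 1; unfold Rdiv; ring).
  lra.
Qed.

Lemma pth_moment_nonneg (k lambda p : R) (h g : C -> C) (r : R) :
  qc_map k lambda h g -> 0 < r < 1 -> 0 <= pth_moment p h g r.
Proof.
  intros Q Hr. pose proof PI_RGT_0 as Hpi. apply RInt_ge_0; [lra| |].
  - apply ex_RInt_continuous_R, (harm_power_section k lambda); assumption.
  - intros a _. left. apply Rpower_pos.
Qed.

(** For [r >= 1/2] the function
    [log (I + E) + p / (1 - s) * (1 - r)^(1 - s)] is nonincreasing, by
    [pth_moment_derivative_le].  The packing estimates need [r] away from [0]; for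
    [r < 1/2] the pointwise growth bound suffices. *)
Lemma pth_moment_bounded (k lambda p : R) (h g : C -> C) :
  qc_map k lambda h g -> 0 < p -> p * (lambda - 1) < 1 ->
  exists B, 0 < B /\ forall r, 0 < r < 1 -> pth_moment p h g r <= B.
Proof.
  intros Q Hp Hq.
  pose proof (qc_lambda _ _ _ _ Q) as Hl. pose proof (qc_k _ _ _ _ Q) as Hk.
  pose proof (growth_const_pos lambda Hl) as HG. pose proof PI_RGT_0 as Hpi.
  pose proof (energy_const_pos k lambda p Hk Hl Hp) as HE.
  set (E := energy_const k lambda p) in *.
  set (s := (1 + p * (lambda - 1)) / 2).
  assert (Hs : 0 < 1 - s) by (unfold s; lra).
  set (prim := fun r => p / (1 - s) * Rpower (1 - r) (1 - s)).
  set (I := pth_moment p h g) in *.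
  set (B1 := exp (ln (I (/ 2) + E) + prim (/ 2))).
  set (B2 := 2 * PI * Rpower (growth_const lambda * Rpower 2 (lambda - 1)) p).
  assert (HB2 : 0 < B2).
  { unfold B2. pose proof (Rpower_pos (growth_const lambda * Rpower 2 (lambda - 1)) p).
    apply Rmult_lt_0_compat; lra. }
  exists (B1 + B2). split.
  { unfold B1. pose proof (exp_pos (ln (I (/ 2) + E) + prim (/ 2))). lra. }
  intros r Hr. destruct (Rle_dec (/ 2) r) as [Hr2|Hr2].
  - assert (HI : forall x, / 2 <= x <= r -> 0 < I x + E).
    { intros x Hx. unfold I.
      pose proof (pth_moment_nonneg k lambda p h g x Q ltac:(lra)). lra. }
    assert (Hprim : forall x, / 2 <= x <= r ->
      is_derive prim x (- (p * Rpower (1 - x) (- s)))).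
    { intros x Hx. unfold prim.
      replace (Rpower (1 - x) (- s)) with (Rpower (1 - x) (1 - s) / (1 - x)).
      2:{ replace (1 - s) with (1 + - s) by ring.
          rewrite Rpower_plus, Rpower_1 by lra. field. lra. }
      unfold Rpower. auto_derive; [lra|]. unfold Rminus. field. unfold s; lra. }
    assert (H : - (ln (I (/ 2) + E) + prim (/ 2)) <= - (ln (I r + E) + prim r)).
    { apply (derive_nonneg_le (fun x => - (ln (I x + E) + prim x))
        (fun x => p * Rpower (1 - x) (- s)
           - RInt (radial_density p h g x) 0 (2 * PI) / (I x + E))).
      - exact Hr2.
      - intros x Hx. specialize (HI x Hx). specialize (Hprim x Hx).
        pose proof (pth_moment_derive k lambda p h g x Q ltac:(lra)) as HD.
        fold I in HD. set (dI := RInt _ _ _) in *. clearbody I prim dI.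
        auto_derive.
        + repeat split; [eexists; exact HD|exact HI|eexists; exact Hprim].
        + replace (Derive (fun x => I x) x) with dI
            by (symmetry; apply is_derive_unique; exact HD).
          replace (Derive (fun x => prim x) x) with (- (p * Rpower (1 - x) (- s)))
            by (symmetry; apply is_derive_unique; exact Hprim).
          field. lra.
      - intros x Hx. specialize (HI x Hx).
        pose proof (pth_moment_derivative_le k lambda p s h g x Q Hp ltac:(lra)
          ltac:(unfold s; lra)) as HD. fold I E in HD.
        set (dI := RInt _ _ _) in *.
        assert (dI / (I x + E) <= p * Rpower (1 - x) (- s)).
        { apply Rmult_le_reg_r with (I x + E); [exact HI|].
          unfold Rdiv. rewrite Rmult_assoc, Rinv_l by lra. lra. }
        lra. }
    assert (Hpr : 0 <= prim r).
    { unfold prim. left. apply Rmult_lt_0_compat; [|apply Rpower_pos].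
      apply Rdiv_lt_0_compat; lra. }
    assert (HIr := HI r ltac:(lra)).
    assert (I r + E <= B1).
    { rewrite <- (exp_ln (I r + E)) by exact HIr. unfold B1.
      assert (Hle : ln (I r + E) <= ln (I (/ 2) + E) + prim (/ 2)) by lra.
      apply exp_le_compat, Hle. }
    lra.
  - assert (HB1 : 0 < B1) by apply exp_pos.
    assert (I r <= B2); [|lra].
    unfold I, pth_moment, B2.
    replace (2 * PI) with (2 * PI - 0) at 2 by ring.
    apply (is_RInt_le_const
      (fun a => Rpower (Cmod (harm h g (circle_point r a))) p)); [lra| |].
    + apply (@RInt_correct R_CompleteNormedModule), ex_RInt_continuous_R.
      apply (harm_power_section k lambda); assumption.
    + intros a _. apply Rle_Rpower_l; [lra|]. split.
      * apply (harm_circle_pos k lambda); assumption.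
      * assert (Hz : Cmod (circle_point r a) = r) by (apply Cmod_circle_point; lra).
        eapply Rle_trans.
        { apply (harm_growth k lambda); [exact Q|unfold unit_disk; lra]. }
        rewrite Hz. apply Rmult_le_compat_l; [lra|].
        replace (1 - lambda) with (- (lambda - 1)) by ring.
        rewrite Rpower_Ropp.
        replace (Rpower 2 (lambda - 1)) with (/ Rpower (/ 2) (lambda - 1)).
        2:{ unfold Rpower. rewrite ln_Rinv, <- exp_Ropp by lra. f_equal. ring. }
        apply Rinv_le_contravar; [apply Rpower_pos|].
        apply Rle_Rpower_l; lra.
Qed.

Lemma pow_nonneg_le (x B e : R) :
  0 <= x <= B -> 0 < B -> 0 < e -> pow_nonneg x e <= Rpower B e.
Proof.
  intros Hx HB He. unfold pow_nonneg. destruct (Req_EM_T x 0) as [E|E].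
  - left. apply Rpower_pos.
  - apply Rle_Rpower_l; lra.
Qed.

Theorem theorem2 (K lambda : R) (h g : C -> C)
  (hK : 1 <= K) (hlambda : 1 < lambda)
  (hf : class_FH K lambda h g) :
  forall p : R, 0 < p < 1 / (lambda - 1) -> hp p (harm h g).
Proof.
  intros p [Hp Hpl].
  pose proof (class_FH_qc_map K lambda h g hK hlambda hf) as Q.
  pose proof PI_RGT_0 as Hpi.
  split; [apply harm_harmonic; apply Q|].
  assert (Hq : p * (lambda - 1) < 1).
  { apply Rmult_lt_reg_r with (/ (lambda - 1)); [apply Rinv_0_lt_compat; lra|].
    rewrite Rmult_assoc, Rinv_r by lra. lra. }
  destruct (pth_moment_bounded _ _ p h g Q Hp Hq) as [B [HB HI]].
  assert (Hlub : Rbar_le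
    (sup_on (fun r => 0 < r < 1) (fun r => Mp p r (harm h g)))
    (Rpower (/ (2 * PI) * B) (1 / p))).
  { apply Lub_Rbar_correct. intros y [r [Hr ->]]. simpl.
    assert (Hinv : 0 < / (2 * PI)) by (apply Rinv_0_lt_compat; lra).
    unfold Mp. apply pow_nonneg_le.
    - replace (RInt _ 0 (2 * PI)) with (pth_moment p h g r).
      + split.
        * apply Rmult_le_pos; [lra|].
          apply (pth_moment_nonneg _ _ p h g r Q Hr).
        * apply Rmult_le_compat_l; [lra|apply HI, Hr].
      + apply RInt_ext. intros a _. unfold pow_nonneg.
        pose proof (harm_circle_pos _ _ h g r a Q Hr).
        destruct Req_EM_T as [E|_]; [lra|reflexivity].
    - apply Rmult_lt_0_compat; assumption.
    - apply Rdiv_lt_0_compat; lra. }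
  destruct (sup_on (fun r => 0 < r < 1) (fun r => Mp p r (harm h g)));
    simpl in *; auto.
Qed.
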